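(* Let $X$ be a compact geodesic space, $E$ a chained entourage in $X$, and $c$ a closed curve in $X$. Then $c$ has a shortest curve $\overline{c}$ in its free $E$-homotopy class, and for any such $\overline{c}$: (1) $\overline{c}$ is non-constant if and only if $E$ is essential; (2) if $\overline{c}$ is non-constant then $\overline{c}$ is a closed $\frac{3\varepsilon}{2}$-geodesic whenever $E_\varepsilon\subset E$.
   Context: A geodesic space is a metric space $(X,d)$ in which any two points $x,y$ are joined by a curve of length $d(x,y)$. Rectifiable curves are parameterized proportionally to arclength. An entourage in $X$ is a symmetric subset $E\subset X\times X$ containing $E_\varepsilon:=\{(x,y):d(x,y)<\varepsilon\}$ for some $\varepsilon>0$. $B(x,E):=\{y:(x,y)\in E\}$. An $E$-chain is a finite sequence $\{x_0,\dots,x_n\}$ with $(x_i,x_{i+1})\in E$ for all $i$; it is an $E$-loop if $x_0=x_n$. An $E$-homotopy between $E$-chains is a finite sequence of $E$-chains with the same endpoints, each obtained from the previous one by inserting or removing a single point (never an endpoint), every step remaining an $E$-chain (a chain $\{x,x\}$ is identified with $\{x\}$). An $E$-loop is $E$-null if it is $E$-homotopic to the trivial (one-point) chain. Concatenation is $\ast$, reversal is $\overline{\alpha}$. $E$-loops $\lambda_1,\lambda_2$ are freely $E$-homotopic if there are $E$-chains $\alpha,\beta$ from a common point to the initial points of $\lambda_1,\lambda_2$, respectively, such that $\alpha\ast\lambda_1\ast\overline{\alpha}$ is $E$-homotopic to $\beta\ast\lambda_2\ast\overline{\beta}$. $E$ is chained if $E$ is contained in the closure of its interior and whenever $(x,y)\in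 E$ and $F$ is an entourage, $x,y$ can be joined by an $F$-chain lying in $B(x,E)\cap B(y,E)$. A chained entourage $E$ is essential if there is an $E$-loop that is not $E$-null. An $E$-subdivision of a curve $c:[0,1]\to X$ is an $E$-chain $\{c(t_0),\dots,c(t_n)\}$ with $0=t_0\le\dots\le t_n=1$ and $c([t_i,t_{i+1}])\subset B(c(t_i),E)\cap B(c(t_{i+1}),E)$ for all $i$. Closed curves are freely $E$-homotopic if they have $E$-subdivisions that are freely $E$-homotopic. A closed curve is a closed $\varepsilon$-geodesic if, parameterized by arclength, every segment of it of length $\varepsilon$ is minimizing (the distance between its endpoints is $\varepsilon$), including segments having the common start/end point of the closed curve in their interior.
   Formalization: Part (1) is false as printed (c constant, E essential); it is proved as: the shortest curve is non-constant iff E is essential and c is not E-null. Also proved: E is essential iff some closed curve has only non-constant shortest curves in its free E-homotopy class. *)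

(* Defs.v *)
From HB Require Import structures.
From mathcomp Require Import all_boot all_order all_algebra.
From mathcomp Require Import all_classical all_reals all_analysis.

Set Implicit Arguments.
Unset Strict Implicit.
Unset Printing Implicit Defensive.

Import Order.TTheory GRing.Theory Num.Theory.
Import numFieldNormedType.Exports.

Local Open Scope classical_set_scope.
Local Open Scope ring_scope.

Section Definitions.
Context {R : realType} {X : metricType R}.
Implicit Types (E F : set (X * X)) (x y z : X) (p q a b : seq X) (c : R -> X).

(** Curves are functions R -> X of which only the values on [0, 1] matter. *)

Definition curve c : Prop := {within `[0, 1], continuous c}.

Definition closed_curve c : Prop := curve c /\ c 0 = c 1.

Definition nonconstant c : Prop :=
  exists s t : R, [/\ s \in `[0, 1], t \in `[0, 1] & c s <> c t].

(* The metric-space analogues of variation and total_variation; the partition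
   of [s, t] is s :: ts, with t the last item of ts. *)
Definition chord_length c (s t : R) (ts : seq R) : R :=
  let P n := c (nth t (s :: ts) n) in
  \sum_(0 <= n < size ts) mdist (P n) (P n.+1).

Definition curve_length c (s t : R) : \bar R :=
  ereal_sup [set (chord_length c s t ts)%:E | ts in itv_partition s t].

(* Rectifiable, and parameterized on [0, 1] proportionally to arclength. *)
Definition proportional_to_arclength c : Prop :=
  exists L : R, forall t : R, t \in `[0, 1] -> curve_length c 0 t = (t * L)%:E.

(** Entourages *)

Definition metric_entourage (eps : R) : set (X * X) :=
  [set xy | mdist xy.1 xy.2 < eps].

Definition is_entourage E : Prop :=
  (forall x y, E (x, y) -> E (y, x)) /\
  exists2 eps : R, 0 < eps & metric_entourage eps `<=` E.

(** The chain {x, p_0, ..., p_n} is given by its first point x and the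
    sequence p of its other points, as in mathcomp.boot.path; the one-point
    chain is x with p = [::]. Concatenation is then concatenation of the tails.
    B(x, E) is xsection E x. *)

Definition chain E x p : bool := path (fun y z => (y, z) \in E) x p.

Definition loop E x p : Prop := chain E x p /\ last x p = x.

(* The points of the reversed chain, except its first point last x p. *)
Definition reversal x p : seq X := rev (belast x p).

(* Insertion of y away from the endpoints. The second case identifies {x} with
   {x, x}, which is not such an insertion. *)
Definition insertion x p q : Prop :=
  (exists u y v, [/\ v != [::], p = u ++ v & q = u ++ y :: v]) \/
  (p = [::] /\ q = [:: x]).

Definition homotopy_step E x p q : Prop :=
  [/\ chain E x p, chain E x q & insertion x p q \/ insertion x q p].

Definition homotopic E x p q : Prop :=
  chain E x p /\
  exists ps : seq (seq X),
    path (fun p1 p2 => `[< homotopy_step E x p1 p2 >]) p ps /\ last p ps = q.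

Definition null_loop E x p : Prop := loop E x p /\ homotopic E x p [::].

Definition freely_homotopic E x p y q : Prop :=
  [/\ loop E x p, loop E y q &
    exists z a b,
      [/\ chain E z a /\ last z a = x, chain E z b /\ last z b = y &
          homotopic E z (a ++ p ++ reversal z a) (b ++ q ++ reversal z b)]].

Definition chained E : Prop :=
  [/\ is_entourage E,
      E `<=` closure (interior E) &
      forall x y F, E (x, y) -> is_entourage F ->
        exists p, [/\ chain F x p, last x p = y &
          forall z, z \in x :: p -> (xsection E x `&` xsection E y) z]].

Definition essential E : Prop := exists x p, loop E x p /\ ~ null_loop E x p.

(* The subdivision is the E-chain with first point c 0 and tail p. *)
Definition subdivision E c p : Prop :=
  exists ts : seq R,
    [/\ path (fun s t => `[< s <= t /\
          c @` `[s, t] `<=` xsection E (c s) `&` xsection E (c t) >]) 0 ts,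
        last 0 ts = 1 & p = map c ts].

Definition freely_homotopic_curves E c c' : Prop :=
  exists p q, [/\ subdivision E c p, subdivision E c' q &
                  freely_homotopic E (c 0) p (c' 0) q].

Definition null_curve E c : Prop :=
  exists p, subdivision E c p /\ null_loop E (c 0) p.

Definition in_free_class E c c' : Prop :=
  closed_curve c' /\ freely_homotopic_curves E c c'.

Definition shortest_in_free_class E c cb : Prop :=
  in_free_class E c cb /\
  forall c', in_free_class E c c' ->
    (curve_length cb 0 1 <= curve_length c' 0 1)%E.

(* Lengths of segments are measured by curve_length, so that c need not be
   parameterized by arclength. The second clause concerns the segments running
   from c t through the common start/end point c 1 = c 0 to c s. *)
Definition closed_geodesic (eps : R) c : Prop :=
  closed_curve c /\
  forall s t : R, 0 <= s -> s <= t -> t <= 1 ->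
    (curve_length c s t = eps%:E -> mdist (c s) (c t) = eps) /\
    ((curve_length c t 1 + curve_length c 0 s)%E = eps%:E ->
       mdist (c t) (c s) = eps).

End Definitions.

Definition geodesic_space {R : realType} (X : metricType R) : Prop :=
  forall x y : X, exists c : R -> X,
    [/\ curve c, c 0 = x, c 1 = y & curve_length c 0 1 = (mdist x y)%:E].

(* Main.v *)
Require Import Defs.
From HB Require Import structures.
From mathcomp Require Import all_boot all_order all_algebra.
From mathcomp Require Import all_classical all_reals all_analysis.
From mathcomp Require Import lra zify.

Set Implicit Arguments.
Unset Strict Implicit.
Unset Printing Implicit Defensive.

Import Order.TTheory GRing.Theory Num.Theory.
Import numFieldNormedType.Exports.

Local Open Scope classical_set_scope.
Local Open Scope ring_scope.

(** By compactness, among the loops of N points whose steps are at most delta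
    and which belong to the given free class, some loop has minimal chain length;
    the class is closed because pointwise close loops are freely homotopic.
    Merging consecutive short steps turns any fine loop into one with a number
    of points controlled by its length, so for N large this loop is minimal among
    all fine loops of the class. Joining its points by geodesics gives a shortest
    curve, and conversely a fine subdivision of a curve is never longer than the
    curve.

    If an arc of length 3 eps / 2 of a shortest curve were not minimizing, a
    geodesic between its endpoints would form with it a loop of length less than
    3 eps. Such a loop is covered by three arcs of length less than eps, hence is
    null, so replacing the arc by the geodesic would shorten the curve within its
    free class. *)

(** * Homotopies of chains *)

Section ChainHomotopy.
Context {R : realType} {X : metricType R} (E : set (X * X)).
Hypothesis Erefl : forall x, E (x, x).
Hypothesis Esym : forall x y, E (x, y) -> E (y, x).
Implicit Types (x y z : X) (p q r u v a b : seq X).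

Lemma chain_nil x : chain E x [::].
Proof. by []. Qed.

Lemma chain_cons x y p : chain E x (y :: p) <-> E (x, y) /\ chain E y p.
Proof.
rewrite /chain /=; split=> [/andP[xy ->]|[xy ->]]; first by split=> //; apply/set_mem.
by rewrite andbT; apply/mem_set.
Qed.

Lemma chain_cat x p q :
  chain E x (p ++ q) <-> chain E x p /\ chain E (last x p) q.
Proof. by rewrite /chain cat_path; split=> [/andP|[-> ->]]. Qed.

Lemma homotopic_refl x p : chain E x p -> homotopic E x p p.
Proof. by move=> xp; split=> //; exists [::]. Qed.

Lemma homotopic_step x p q r :
  homotopy_step E x p q -> homotopic E x q r -> homotopic E x p r.
Proof.
move=> pq [_ [ps [qps lps]]]; split; first by case: pq.
by exists (q :: ps) => /=; split=> //; rewrite qps andbT; apply/asboolP.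
Qed.

(** Packages the list of intermediate chains as an induction on the first step, so that later proofs
    never handle that list. *)
Lemma homotopic_ind x (P : seq X -> seq X -> Prop) :
  (forall p, chain E x p -> P p p) ->
  (forall p q r, homotopy_step E x p q -> homotopic E x q r -> P q r -> P p r) ->
  forall p q, homotopic E x p q -> P p q.
Proof.
move=> Prefl Pstep p q [xp [ps [pps <-]]].
elim: ps p xp pps => [|p' ps ih] p xp /=; first by move=> _; apply: Prefl.
move=> /andP[/asboolP st pps]; have xp' : chain E x p' by case: st.
by apply: (Pstep _ p') => //; [split=> //; exists ps|apply: ih].
Qed.

Lemma homotopic_trans x p q r :
  homotopic E x p q -> homotopic E x q r -> homotopic E x p r.
Proof.
move=> pq; move: p q pq r; apply: homotopic_ind => // p q s pq _ ih r sr.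
by apply: homotopic_step pq _; apply: ih.
Qed.

Lemma homotopy_step_sym x p q : homotopy_step E x p q -> homotopy_step E x q p.
Proof. by move=> [xp xq pq]; split=> //; rewrite or_comm. Qed.

Lemma homotopic_of_step x p q : homotopy_step E x p q -> homotopic E x p q.
Proof.
by move=> st; apply: (homotopic_step st); apply: homotopic_refl; case: st.
Qed.

Lemma homotopic_sym x p q : homotopic E x p q -> homotopic E x q p.
Proof.
move: p q; apply: homotopic_ind => [p|p q r pq _ rq]; first exact: homotopic_refl.
by apply: homotopic_trans rq _; apply/homotopic_of_step/homotopy_step_sym.
Qed.

Lemma homotopic_chain x p q : homotopic E x p q -> chain E x p /\ chain E x q.
Proof. by move=> pq; split; [case: pq|case: (homotopic_sym pq)]. Qed.

Lemma insertion_last x p q : insertion x p q -> last x p = last x q.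
Proof.
by case=> [[u [y [v [v0 -> ->]]]]|[-> ->]//]; rewrite !last_cat /=; case: v v0.
Qed.

Lemma homotopic_last x p q : homotopic E x p q -> last x p = last x q.
Proof.
move: p q; apply: homotopic_ind => // p q r [_ _ pq] _ <-.
by case: pq => /insertion_last.
Qed.

Lemma insertion_homotopic_cat x u v y p q : insertion y p q ->
  last x u = y -> chain E x (u ++ p ++ v) -> chain E x (u ++ q ++ v) ->
  homotopic E x (u ++ p ++ v) (u ++ q ++ v).
Proof.
move=> ins xu xp xq; apply: homotopic_of_step; split=> //; left.
case: ins => [[u1 [w [v1 [v10 pE qE]]]]|[pE qE]]; rewrite pE qE.
  left; exists (u ++ u1), w, (v1 ++ v); rewrite -!catA /=; split=> //.
  by case: v1 v10 {pE qE}.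
(* If [v] is empty, the repeated point stands at the end, where [insertion] forbids adding a point.
   For nonempty [u] the copy of [y] is then inserted before the final [y] instead of after it; for
   empty [u] it is the identification of the one-point chain with its repetition. *)
have [v0|v0] := eqVneq v [::]; last by left; exists u, y, v.
subst v; case/lastP: u xu {xp xq} => [/= ->|u z]; first by right.
rewrite last_rcons => ->; left; exists u, y, [:: y]; split=> //.
  by rewrite cats0 cats1.
by rewrite /= cat_rcons.
Qed.

Lemma homotopic_cat x u v y p q : homotopic E y p q ->
  chain E x u -> last x u = y -> chain E (last y p) v ->
  homotopic E x (u ++ p ++ v) (u ++ q ++ v).
Proof.
move=> pq xu lu; move: p q pq; apply: homotopic_ind => [p yp pv|p q r st qr ih pv].
  by apply: homotopic_refl; rewrite !chain_cat lu.
have pq : last y p = last y q by apply: homotopic_last (homotopic_of_step st).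
apply: homotopic_trans (ih _); last by rewrite -pq.
case: st => yp yq ins.
have xp : chain E x (u ++ p ++ v) by rewrite !chain_cat lu.
have xq : chain E x (u ++ q ++ v) by rewrite !chain_cat lu -pq.
case: ins => ins; first exact: insertion_homotopic_cat ins lu xp xq.
exact/homotopic_sym/(insertion_homotopic_cat ins lu xq xp).
Qed.

Lemma homotopic_catl x u p q : homotopic E (last x u) p q -> chain E x u ->
  homotopic E x (u ++ p) (u ++ q).
Proof.
by move=> pq xu; have := @homotopic_cat x u [::] _ p q pq xu erefl isT; rewrite !cats0.
Qed.

Lemma homotopic_catr x v p q : homotopic E x p q -> chain E (last x p) v ->
  homotopic E x (p ++ v) (q ++ v).
Proof. by move=> pq; apply: (@homotopic_cat x [::]). Qed.

Lemma homotopic_cons x y p q : homotopic E y p q -> E (x, y) ->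
  homotopic E x (y :: p) (y :: q).
Proof.
by move=> pq xy; apply: (@homotopic_catl x [:: y]) => //; apply/chain_cons.
Qed.

Lemma homotopic_cat2 x p p' q q' : homotopic E x p p' ->
  homotopic E (last x p) q q' -> homotopic E x (p ++ q) (p' ++ q').
Proof.
move=> pp' qq'; apply: (homotopic_trans (homotopic_catl qq' (homotopic_chain pp').1)).
by apply: homotopic_catr pp' (homotopic_chain qq').2.
Qed.

Lemma homotopic_repeat x : homotopic E x [:: x] [::].
Proof.
apply/homotopic_sym/homotopic_of_step; split=> //; first exact/chain_cons.
by left; right.
Qed.

Lemma homotopic_remove x y z p : E (x, y) -> E (y, z) -> E (x, z) ->
  chain E z p -> homotopic E x [:: y, z & p] (z :: p).
Proof.
move=> xy yz xz zp; apply: homotopic_of_step; split; try by do !(apply/chain_cons; split=> //).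
by right; left; exists [::], y, (z :: p).
Qed.

Lemma homotopic_nseq x k : homotopic E x (nseq k x) [::].
Proof.
elim: k => [|k ih] /=; first exact: homotopic_refl.
exact: homotopic_trans (homotopic_cons ih (Erefl x)) (homotopic_repeat x).
Qed.

(** Lets loops with different numbers of points be compared as loops with one common number of
    points. *)
Lemma homotopic_pad x p k : chain E x p ->
  homotopic E x p (p ++ nseq k (last x p)).
Proof.
move=> xp; rewrite -{1}[p]cats0; apply: homotopic_catl => //.
exact/homotopic_sym/homotopic_nseq.
Qed.

(** Every point sees the last one, so the points in between can be removed one at a time, starting
    from the end. *)
Lemma homotopic_fan x q : chain E x q ->
  (forall z, z \in x :: q -> E (z, last x q)) -> homotopic E x q [:: last x q].
Proof.
elim: q x => [|y q ih] x /=; first by move=> _ _; apply/homotopic_sym/homotopic_repeat.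
move=> /chain_cons[xy yq] fan.
apply: (homotopic_trans (homotopic_cons (ih y yq _) xy)).
  by move=> z zq; apply: fan; rewrite in_cons zq orbT.
by apply: homotopic_remove => //; apply: fan; rewrite !in_cons eqxx ?orbT.
Qed.

Lemma reversal_cons x y p : reversal x (y :: p) = reversal y p ++ [:: x].
Proof. by rewrite /reversal /= rev_cons cats1. Qed.

Lemma reversal_cat x p q :
  reversal x (p ++ q) = reversal (last x p) q ++ reversal x p.
Proof. by rewrite /reversal belast_cat rev_cat. Qed.

Lemma last_reversal x p : last (last x p) (reversal x p) = x.
Proof. by case: p => [|y p] //; rewrite reversal_cons last_cat. Qed.

Lemma reversalK x p : reversal (last x p) (reversal x p) = p.
Proof.
elim: p x => [|y p ih] x //.
by rewrite reversal_cons reversal_cat /= last_reversal ih.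
Qed.

Lemma chain_reversal x p : chain E x p -> chain E (last x p) (reversal x p).
Proof.
elim: p x => [|y p ih] x // /chain_cons[xy /ih yp].
rewrite reversal_cons /=; apply/chain_cat; split=> //.
by rewrite last_reversal; apply/chain_cons; split=> //; apply: Esym.
Qed.

Lemma homotopic_reversal x p : chain E x p ->
  homotopic E x (p ++ reversal x p) [::].
Proof.
elim: p x => [|y p ih] x; first by move=> _; apply: homotopic_refl.
move=> /chain_cons[xy yp]; have yx := Esym xy.
rewrite reversal_cons catA.
have h := @homotopic_catr y [:: x] _ _ (ih _ yp).
apply: (homotopic_trans (homotopic_cons (h _) xy)).
  by rewrite last_cat last_reversal; apply/chain_cons.
exact: homotopic_trans (homotopic_remove xy yx (Erefl x) (chain_nil x)) (homotopic_repeat x).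
Qed.

Lemma reversal_homotopic x p : chain E x p ->
  homotopic E (last x p) (reversal x p ++ p) [::].
Proof. by move=> /chain_reversal/homotopic_reversal; rewrite reversalK. Qed.

(** The rungs and diagonals cut the strip between [p] and [q] into triangles, and [p] is pushed
    across them one by one. The last rung leads back to the endpoint of [p]. *)
Lemma homotopic_ladder x y p q : size p = size q ->
  (forall i, (i <= size p)%N -> E (nth x (x :: p) i, nth y (y :: q) i)) ->
  (forall i, (i < size p)%N -> E (nth y (y :: q) i, nth x (x :: p) i.+1)) ->
  chain E x p -> chain E y q ->
  homotopic E x p (y :: q ++ [:: last x p]).
Proof.
elim: p q x y => [|x1 p ih] [|y1 q] x y //=.
  move=> _ /(_ 0%N isT)/= xy _ _ _; have yx := Esym xy.
  apply/homotopic_sym.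
  exact: homotopic_trans (homotopic_remove xy yx (Erefl x) (chain_nil x)) (homotopic_repeat x).
move=> [spq] vert diag /chain_cons[xx1 x1p] /chain_cons[yy1 y1q].
have xy : E (x, y) by have := vert 0%N isT.
have x1y1 : E (x1, y1) by have := vert 1%N isT.
have yx1 : E (y, x1) by have := diag 0%N isT.
have h : homotopic E x1 p (y1 :: q ++ [:: last x1 p]).
  apply: ih => // i ip.
    have := vert i.+1 ip => /=.
    rewrite (set_nth_default x1) //= (@set_nth_default _ (y1 :: q) y1) //=.
    by rewrite -spq.
  have := diag i.+1 ip => /=.
  rewrite (@set_nth_default _ p x1) // (@set_nth_default _ (y1 :: q) y1) //=.
  by rewrite -spq ltnW.
apply: (homotopic_trans (homotopic_cons h xx1)).
have ch := (homotopic_chain h).2.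
(* Two triangles per rung: [y] is inserted between [x] and [x1], then [x1] is removed between [y]
   and [y1]. *)
apply: (@homotopic_trans _ _ [:: y, x1, y1 & q ++ [:: last x1 p]]).
  by apply/homotopic_sym; apply: homotopic_remove.
apply: homotopic_cons => //; apply: homotopic_remove => //.
by move/chain_cons: ch => [].
Qed.

(* Free homotopy with the two conjugating chains merged into a single one. *)
Definition conjugate x p y q : Prop :=
  [/\ loop E x p, loop E y q &
    exists b, [/\ chain E x b, last x b = y &
                  homotopic E x p (b ++ q ++ reversal x b)]].

(** Conjugating by the reversal of [a] cancels [a] on one side and turns [b] into
    [reversal z a ++ b] on the other. *)
Lemma freely_homotopicP x p y q :
  freely_homotopic E x p y q <-> conjugate x p y q.
Proof.
split=> [[lp lq [z [a [b [[za ax] [zb By] h]]]]]|[lp lq [b [xb By h]]]]; last first.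
  by split=> //; exists x, [::], b; split=> //; rewrite /= cats0.
split=> //; have [xp px] := lp; have [yq qy] := lq.
have xa : chain E x (reversal z a) by rewrite -ax; apply: chain_reversal.
have az : last x (reversal z a) = z by rewrite -ax last_reversal.
have aa : homotopic E x (reversal z a ++ a) [::] by rewrite -ax; apply: reversal_homotopic.
exists (reversal z a ++ b); split; [by rewrite chain_cat az|by rewrite last_cat az|].
rewrite reversal_cat az -[X in reversal X (reversal _ _)]ax reversalK.
apply: (@homotopic_trans _ _ (reversal z a ++ (a ++ p ++ reversal z a) ++ a)).
  rewrite -!catA catA -[p in X in homotopic _ _ X _]cats0.
  apply: (homotopic_cat2 (homotopic_sym aa)); apply: homotopic_catl => //.
  by rewrite px; apply: homotopic_sym.
rewrite -!catA; apply: homotopic_catl => //; rewrite az.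
have := @homotopic_catr _ a _ _ h; rewrite -!catA; apply.
by rewrite !last_cat ax px az.
Qed.

Lemma homotopic_conjugate x p q : loop E x p -> homotopic E x p q ->
  conjugate x p x q.
Proof.
move=> lp pq; split=> //.
  by split; [apply: (homotopic_chain pq).2|rewrite -(homotopic_last pq) lp.2].
by exists [::]; split=> //; rewrite cats0.
Qed.

Lemma conjugate_trans x p y q z r :
  conjugate x p y q -> conjugate y q z r -> conjugate x p z r.
Proof.
move=> [lp lq [b [xb By h]]] [_ lr [b' [yb' bz h']]]; split=> //.
exists (b ++ b'); split; [by rewrite chain_cat By|by rewrite last_cat By|].
apply: (homotopic_trans h); rewrite reversal_cat By -!catA.
have := @homotopic_cat x b (reversal x b) _ _ _ h' xb By; rewrite -!catA; apply.
by rewrite lq.2 -By; apply: chain_reversal.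
Qed.

(** Moves the base point along the loop: [u] itself is the conjugating chain, since the [u] at the
    end of the rotated loop cancels against its reversal. *)
Lemma conjugate_rotate x u v : loop E x (u ++ v) ->
  conjugate x (u ++ v) (last x u) (v ++ u).
Proof.
move=> [/chain_cat[xu uv] vx]; rewrite last_cat in vx; split.
- by split; [rewrite chain_cat|rewrite last_cat].
- by split; [rewrite chain_cat vx|rewrite last_cat vx].
exists u; split=> //; rewrite -catA; apply: homotopic_catl => //.
rewrite -[v in X in homotopic _ _ X _]cats0; apply: homotopic_catl => //.
by rewrite vx; apply/homotopic_sym/homotopic_reversal.
Qed.

Lemma conjugate_null x p y q : conjugate x p y q ->
  homotopic E y q [::] -> homotopic E x p [::].
Proof.
move=> [lp lq [b [xb By h]]] q0; apply: (homotopic_trans h).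
apply: homotopic_trans (homotopic_reversal xb).
apply: homotopic_catl => //; rewrite By; apply: (@homotopic_catr _ _ _ [::]) q0 _.
by rewrite lq.2 -By; apply: chain_reversal.
Qed.

End ChainHomotopy.

(** * Chains with small steps *)

Section Fine.
Context {R : realType} {X : metricType R}.
Implicit Types (E : set (X * X)) (x y z : X) (p q r u v : seq X) (eps delta mu : R).

Fixpoint chain_length x p : R :=
  if p is y :: p' then mdist x y + chain_length y p' else 0.

Lemma chain_length_ge0 x p : 0 <= chain_length x p.
Proof. by elim: p x => //= y p ih x; rewrite addr_ge0 ?mdist_ge0. Qed.

Lemma chain_length_cat x p q :
  chain_length x (p ++ q) = chain_length x p + chain_length (last x p) q.
Proof. by elim: p x => [|y p ih] x /=; rewrite ?add0r // ih addrA. Qed.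

Lemma mdist_le_chain_length x p : mdist x (last x p) <= chain_length x p.
Proof.
elim: p x => [|y p ih] x /=; first by rewrite mdistxx.
by apply: le_trans (metric_triangle _ y _) _; rewrite lerD2l.
Qed.

Definition mesh_le mu x p : bool := path (fun y z => mdist y z <= mu) x p.

Lemma mesh_cat mu x p q : mesh_le mu x (p ++ q) = mesh_le mu x p && mesh_le mu (last x p) q.
Proof. exact: cat_path. Qed.

Lemma mesh_chain E eps mu x p : metric_entourage eps `<=` E -> mu < eps ->
  mesh_le mu x p -> chain E x p.
Proof.
move=> epsE lt_mu; apply: sub_path => y z yz; apply/mem_set/epsE.
exact: le_lt_trans yz lt_mu.
Qed.

Lemma mesh_reversal mu x p : mesh_le mu x p -> mesh_le mu (last x p) (reversal x p).
Proof.
elim: p x => [|y p ih] x //= /andP[xy yp].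
by rewrite reversal_cons mesh_cat ih //= last_reversal metric_sym xy.
Qed.

Lemma chain_length_reversal x p :
  chain_length (last x p) (reversal x p) = chain_length x p.
Proof.
elim: p x => [|y p ih] x //=.
by rewrite reversal_cons chain_length_cat ih /= last_reversal metric_sym addr0 addrC.
Qed.

Lemma mdist_mem_le_chain_length x p z :
  z \in x :: p -> mdist z (last x p) <= chain_length x p.
Proof.
elim: p x => [|y p ih] x; first by rewrite inE => /eqP -> /=; rewrite mdistxx.
rewrite in_cons => /orP[/eqP ->|/ih zy]; first exact: mdist_le_chain_length.
by apply: le_trans zy _; rewrite /= lerDr mdist_ge0.
Qed.

(** Steps are collected as long as the length stays below [t]. If some step remains, adding it would
    reach [t], so at most [mu] is missing. *)
Lemma greedy_prefix mu t x p : 0 < t -> mesh_le mu x p -> exists u v,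
  [/\ p = u ++ v, chain_length x u < t & v = [::] \/ t - mu <= chain_length x u].
Proof.
elim: p x t => [|y p ih] x t t0 /=; first by exists [::], [::]; split=> //; left.
move=> /andP[xy yp]; have [xyt|txy] := ltP (mdist x y) t; last first.
  by exists [::], (y :: p); split=> //=; right; lra.
have [|u [v [-> ut uv]]] := ih y (t - mdist x y) _ yp; first lra.
exists (y :: u), v; split=> //=; first lra.
by case: uv => [->|uv]; [left|right; lra].
Qed.

Lemma mesh_nth mu x p i : mesh_le mu x p -> (i < size p)%N ->
  mdist (nth x (x :: p) i) (nth x (x :: p) i.+1) <= mu.
Proof. by move=> /(pathP x) /(_ i). Qed.

(** * Contracting short loops and merging short steps *)

Section Entourage.
Context (E : set (X * X)) (eps : R).
Hypothesis eps0 : 0 < eps.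
Hypothesis epsE : metric_entourage eps `<=` E.
Hypothesis Esym : forall x y, E (x, y) -> E (y, x).

Lemma sub_entourage_refl x : E (x, x).
Proof. by apply: epsE; rewrite /metric_entourage /= mdistxx. Qed.

Let Erefl := sub_entourage_refl.

Lemma homotopic_short x p : chain E x p -> chain_length x p < eps ->
  homotopic E x p [:: last x p].
Proof.
move=> xp lt_eps; apply: homotopic_fan => // z zp; apply: epsE.
exact: le_lt_trans (mdist_mem_le_chain_length zp) lt_eps.
Qed.

(* Three arcs, each shorter than [eps], cover the loop. *)
Lemma short_loop_null mu x p : mesh_le mu x p -> mu < eps -> last x p = x ->
  chain_length x p + 2 * mu < 3 * eps -> homotopic E x p [::].
Proof.
move=> fp lt_mu lx len.
have [u [v [pE u_eps uv]]] := greedy_prefix eps0 fp.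
move: (fp); rewrite pE mesh_cat => /andP[fu fv].
have [u' [v' [vE u'_eps uv']]] := greedy_prefix eps0 fv.
move: (fv); rewrite vE mesh_cat => /andP[fu' fv'].
(* Unless the loop is exhausted earlier, the first two arcs have length at least [eps - mu] each,
   which leaves less than [3 * eps - 2 * mu - 2 * (eps - mu) = eps] for the third. *)
have v'_eps : chain_length (last (last x u) u') v' < eps.
  case: uv => [v0|uv].
    by move: vE; rewrite v0; case: u' {uv' fu' fv' u'_eps} => //; case: v'.
  case: uv' => [->//|uv'].
  by move: len; rewrite pE vE !chain_length_cat; lra.
move: lx; rewrite pE vE !last_cat => lx.
set y := last x u in v'_eps u'_eps uv' fv fu' fv' lx *.
set z := last y u' in v'_eps fv' lx *.
have C := mesh_chain epsE lt_mu.
have hu : homotopic E x u [:: y] by apply: homotopic_short => //; apply: C.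
have hu' : homotopic E y u' [:: z] by apply: homotopic_short => //; apply: C.
have hv' : homotopic E z v' [:: x].
  by rewrite -[X in [:: X]]lx; apply: homotopic_short => //; apply: C.
(* With each arc replaced by its chord, a triangle with all sides in [E] remains. *)
have h : homotopic E x (u ++ u' ++ v') ([:: y] ++ [:: z] ++ [:: x]).
  apply: (homotopic_cat2 hu).
  exact: (homotopic_cat2 hu' hv').
apply: (homotopic_trans h).
have ch := (homotopic_chain h).2.
move/chain_cons: ch => [xy /chain_cons[yz /chain_cons[zx _]]].
have xz := Esym zx.
apply: (homotopic_trans (homotopic_remove xy yz xz _)).
  by apply/chain_cons.
apply: (homotopic_trans (homotopic_remove xz zx (Erefl x) _)) => //.
exact: homotopic_repeat.
Qed.

(** The steps are grouped in consecutive pairs, each contributing at least [delta]; an odd last step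
    is dropped. *)
Lemma half_size_le_chain_length delta x q :
  (forall u y z v, q = u ++ [:: y, z & v] ->
     delta <= mdist (last x u) y + mdist y z) ->
  (size q)./2%:R * delta <= chain_length x q.
Proof.
have [n] := ubnP (size q); elim: n q x => // n ih [|y [|z v]] x /=.
- by rewrite mul0r.
- by rewrite mul0r addr0 mdist_ge0.
move=> /ltnSE/ltnW ltn red.
have h1 := red [::] y z v erefl.
have : (size v)./2%:R * delta <= chain_length z v.
  apply: ih => // u y' z' v' vE; have := red [:: y, z & u] y' z' v'.
  by rewrite vE => /(_ erefl).
rewrite /= in h1; rewrite -natr1; lra.
Qed.

(** Among the admissible chains one with the fewest points is taken. Two consecutive steps of total
    length below [delta] could be merged into one, giving fewer points, so there are none. *)
Lemma coalesce delta x p : delta < eps -> mesh_le delta x p -> exists q,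
  [/\ mesh_le delta x q, homotopic E x p q, chain_length x q <= chain_length x p &
      (size q)./2%:R * delta <= chain_length x q].
Proof.
move=> lt_delta fp.
pose P n := `[< exists q, [/\ mesh_le delta x q, homotopic E x p q,
  chain_length x q <= chain_length x p & size q = n] >].
have exP : exists n, P n.
  exists (size p); apply/asboolP; exists p; split=> //.
  by apply: homotopic_refl; apply: (mesh_chain epsE lt_delta).
case: (ex_minnP exP) => n /asboolP[q [fq pq le_q szq]] minn.
exists q; split=> //; apply: half_size_le_chain_length => u y z v qE.
rewrite leNgt; apply/negP => short.
have : P (size (u ++ z :: v)).
  apply/asboolP; exists (u ++ z :: v); split=> //.
  - move: fq; rewrite qE !mesh_cat /= => /and4P[-> _ _ ->].
    by rewrite andbT; apply: le_trans (metric_triangle _ y _) _; apply: ltW.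
  - apply: (homotopic_trans pq); rewrite qE.
    move: fq; rewrite qE mesh_cat => /andP[fu /= /and3P[uy yz fv]].
    have C := mesh_chain epsE lt_delta.
    apply: homotopic_catl => //; last exact: C fu.
    apply: homotopic_remove; last exact: C fv.
    + by apply: epsE; apply: le_lt_trans uy lt_delta.
    + by apply: epsE; apply: le_lt_trans yz lt_delta.
    + apply: epsE; apply: le_lt_trans (metric_triangle _ y _) _.
      exact: lt_trans short lt_delta.
  - apply: le_trans le_q; rewrite qE !chain_length_cat /= lerD2l addrA lerD2r.
    exact: metric_triangle.
by move=> /minn; rewrite -szq qE !size_cat /= !addnS ltnn.
Qed.

End Entourage.
End Fine.

(** * Minimal loops *)

Section MinimalLoop.
Context {R : realType} {X : metricType R} (E : set (X * X)) (eps delta : R).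
Hypothesis delta0 : 0 < delta.
Hypothesis lt_delta : delta < eps.
Hypothesis epsE : metric_entourage eps `<=` E.
Hypothesis Esym : forall x y, E (x, y) -> E (y, x).
Hypothesis compactX : compact [set: X].
Implicit Types (x y z : X) (p q : seq X) (f g : {ptws nat -> X}).

Let eps0 : 0 < eps := lt_trans delta0 lt_delta.
Let Erefl : forall x, E (x, x) := sub_entourage_refl eps0 epsE.

(** A loop is read off the values at [0], ..., [N] of a sequence, so that spaces of loops become
    subsets of a product of copies of [X], to which Tychonoff's theorem applies. *)
Definition tail N f : seq X := map f (iota 1 N).

Lemma size_tail N f : size (tail N f) = N.
Proof. by rewrite size_map size_iota. Qed.

Lemma nth_tail N f i : (i <= N)%N -> nth (f 0%N) (f 0%N :: tail N f) i = f i.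
Proof.
by case: i => //= i iN; rewrite (nth_map 0%N) ?size_iota // nth_iota.
Qed.

Lemma last_tail N f : last (f 0%N) (tail N f) = f N.
Proof. by rewrite -(nth_last (f 0%N)) size_tail; have := nth_tail f (leqnn N); case: N. Qed.

Lemma mesh_tail N f :
  mesh_le delta (f 0%N) (tail N f) <-> forall i, (i < N)%N -> mdist (f i) (f i.+1) <= delta.
Proof.
split=> [fd i iN|fd].
  have := mesh_nth fd; rewrite size_tail => /(_ i iN).
  by rewrite !nth_tail // ltnW.
apply/(pathP (f 0%N)) => i; rewrite size_tail => iN.
have := nth_tail f iN; rewrite /= => ->.
by rewrite (nth_tail _ (ltnW iN)); apply: fd.
Qed.

Lemma chain_length_tail N f :
  chain_length (f 0%N) (tail N f) = \sum_(i < N) mdist (f i) (f i.+1).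
Proof.
elim: N => [|N ih]; first by rewrite big_ord0.
have -> : tail N.+1 f = tail N f ++ [:: f N.+1].
  by rewrite /tail -{1}(addn1 N) iotaD map_cat.
by rewrite big_ord_recr /= -ih chain_length_cat last_tail /= addr0.
Qed.

Lemma tail_of_chain N x p : (size p <= N)%N ->
  exists f, f 0%N = x /\ tail N f = p ++ nseq (N - size p) (last x p).
Proof.
move=> szp; exists (fun i => nth (last x p) (x :: p) i); split=> //.
apply: (@eq_from_nth _ (last x p)).
  by rewrite size_tail size_cat size_nseq subnKC.
move=> i; rewrite size_tail => iN; rewrite (nth_map 0%N) ?size_iota // nth_iota //=.
rewrite nth_cat; have [ip|ip] := ltnP i (size p) => //.
by rewrite nth_default // nth_nseq if_same.
Qed.

Lemma near_product N f (eta : R) : 0 < eta ->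
  nbhs f [set g : {ptws nat -> X} | forall i, (i <= N)%N -> mdist (f i) (g i) < eta].
Proof.
move=> eta0; have F : Filter (nbhs f) by exact: _.
have h i : nbhs f [set g : {ptws nat -> X} | mdist (f i) (g i) < eta].
  have b : nbhs (f i) (ball (f i) eta) by apply: nbhsx_ballx.
  have h : nbhs f (proj i @^-1` ball (f i) eta) := @proj_continuous nat (fun=> X) i f _ b.
  by apply: (@filterS _ _ F _ _ _ h) => g; rewrite /= ballEmdist.
elim: N => [|N ih].
  by apply: (@filterS _ _ F _ _ _ (h 0%N)) => g g0 i; rewrite leqn0 => /eqP ->.
apply: (@filterS _ _ F _ _ _ (@filterI _ _ F _ _ ih (h N.+1))) => g [gN gN1] i.
by rewrite leq_eqVlt => /orP[/eqP ->//|/gN].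
Qed.

Lemma chain_length_continuous N : continuous
  (fun f : {ptws nat -> X} => chain_length (f 0%N) (tail N f)).
Proof.
pose S n (f : {ptws nat -> X}) := \sum_(i < n) mdist (f i) (f i.+1).
have -> : (fun f : {ptws nat -> X} => chain_length (f 0%N) (tail N f)) = S N.
  by apply/funext => f; apply: chain_length_tail.
move=> f; have F : Filter (nbhs f) by exact: _.
elim: N => [|i ih].
  have -> : S 0%N = cst 0 by apply/funext => g; rewrite /S big_ord0.
  exact: cvg_cst.
have -> : S i.+1 = S i \+ (fun f => mdist (f i) (f i.+1)).
  by apply/funext => g; rewrite /S big_ord_recr.
apply: cvgD; first exact: ih.
apply/cvgrPdist_lt => e e0 /=.
have e20 : 0 < e / 2 by rewrite divr_gt0.
apply: (@filterS _ _ F _ _ _ (near_product i.+1 f e20)) => g fg.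
have h1 := fg _ (leqnSn i); have h2 := fg _ (leqnn i.+1).
have t1 := metric_triangle (f i) (g i) (f i.+1).
have t2 := metric_triangle (g i) (g i.+1) (f i.+1).
have t3 := metric_triangle (g i) (f i) (g i.+1).
have t4 := metric_triangle (f i) (f i.+1) (g i.+1).
rewrite (metric_sym (g i.+1) (f i.+1)) in t2; rewrite (metric_sym (g i) (f i)) in t3.
rewrite ltr_norml; apply/andP; split; lra.
Qed.

(** The weak bound by [delta] survives limits, whereas [E] is not assumed closed. *)
Definition mesh_loops x0 p0 N : set ({ptws nat -> X}) :=
  [set f | mesh_le delta (f 0%N) (tail N f) /\ conjugate E x0 p0 (f 0%N) (tail N f)].

Lemma closed_mesh_loops x0 p0 N : closed (mesh_loops x0 p0 N).
Proof.
move=> f clf.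
have app (eta : R) : 0 < eta -> exists g, mesh_loops x0 p0 N g /\
    forall i, (i <= N)%N -> mdist (f i) (g i) < eta.
  by move=> /(near_product N f)/clf[g []]; exists g.
have ff : forall i, (i < N)%N -> mdist (f i) (f i.+1) <= delta.
  move=> i iN; apply/ler_addgt0Pl => e e0.
  have [|g [[/mesh_tail/(_ i iN) gg _] fg]] := app (e / 2); first by rewrite divr_gt0.
  have h1 := fg i (ltnW iN); have h2 := fg i.+1 iN.
  have t1 := metric_triangle (f i) (g i) (f i.+1).
  have t2 := metric_triangle (g i) (g i.+1) (f i.+1).
  rewrite (metric_sym (g i.+1) (f i.+1)) in t2; lra.
have fN0 : f N = f 0%N.
  apply: mdist_positivity; apply/eqP; rewrite eq_le mdist_ge0 andbT.
  apply/ler_addgt0Pl => e e0; rewrite addr0.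
  have [|g [[_ [_ [_ gN0] _]] fg]] := app (e / 2); first by rewrite divr_gt0.
  rewrite last_tail in gN0.
  have h1 := fg N (leqnn N); have h2 := fg 0%N (leq0n N).
  have t1 := metric_triangle (f N) (g N) (f 0%N).
  rewrite gN0 (metric_sym (g 0%N)) in t1; rewrite gN0 in h1; lra.
(* At this distance the diagonals from [f i] to [g i.+1] are shorter than
   [delta + (eps - delta) = eps], so the ladder between [g] and [f] lies in [E]. Its first rung is
   the conjugating chain. *)
have [|g [[gg gconj] fg]] := app (eps - delta); first by rewrite subr_gt0.
split; first exact/mesh_tail.
have cf : chain E (f 0%N) (tail N f).
  by apply: (mesh_chain epsE lt_delta); apply/mesh_tail.
have [_ [cg gN0] _] := gconj.
apply: (conjugate_trans Esym gconj); split=> //.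
  by split=> //; rewrite last_tail.
have vert i : (i <= N)%N -> E (g i, f i).
  move=> iN; apply: epsE; rewrite /metric_entourage /= metric_sym.
  by apply: lt_trans (fg i iN) _; rewrite gtrBl.
exists [:: f 0%N]; split=> //; first exact/chain_cons/(conj (vert 0%N isT)).
have {2}<- : last (g 0%N) (tail N g) = g 0%N := gN0.
apply: (homotopic_ladder Erefl Esym) => //; rewrite ?size_tail // => i iN.
  by rewrite !nth_tail //; apply: vert.
rewrite !nth_tail // ?(ltnW iN) //; apply: epsE.
apply: le_lt_trans (metric_triangle _ (f i.+1) _) _.
have h1 := fg i.+1 iN; have h2 := ff i iN; lra.
Qed.

Lemma minimal_loop x0 p0 :
  (exists y q, mesh_le delta y q /\ conjugate E x0 p0 y q) ->
  exists y q, [/\ mesh_le delta y q, conjugate E x0 p0 y q &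
    forall z r, mesh_le delta z r -> conjugate E x0 p0 z r ->
      chain_length y q <= chain_length z r].
Proof.
move=> [y0 [q0 [fq0 cq0]]]; set M := chain_length y0 q0.
(* A coalesced loop of length at most [M] has at most [M / delta] pairs of steps, hence at most [N]
   steps, counting a possible unpaired one. *)
pose N := (2 * (Num.truncn (M / delta)).+1)%N.
(* A competitor of length at most [M] is coalesced to at most [N] steps and then padded with its
   last point, which adds no length. *)
have realize z r : mesh_le delta z r -> conjugate E x0 p0 z r ->
    chain_length z r <= M -> exists2 f, mesh_loops x0 p0 N f &
    chain_length (f 0%N) (tail N f) <= chain_length z r.
  move=> fr cr le_M.
  have [r' [fr' rr' le_r szr']] := coalesce epsE lt_delta fr.
  have szN : (size r' <= N)%N.
    have : (size r')./2%:R <= M / delta.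
      rewrite ler_pdivlMr //; apply: le_trans le_M; apply: le_trans le_r => //.
    have : M / delta < (Num.truncn (M / delta)).+1%:R by apply: truncnS_gt.
    move=> h1 h2; have := le_lt_trans h2 h1; rewrite ltr_nat.
    rewrite /N; have := odd_double_half (size r'); case: odd; lia.
  have [f [f0 fE]] := tail_of_chain z szN.
  have cr' : conjugate E z r z r'.
    by apply: (homotopic_conjugate) => //; case: cr.
  have lr' : last z r' = z by case: cr' => _ [].
  have fch := mesh_chain epsE lt_delta fr'.
  exists f; last first.
    rewrite f0 fE chain_length_cat lr'; apply: le_trans le_r.
    rewrite gerDl; elim: (N - _)%N => //= k; rewrite mdistxx add0r //.
  split; rewrite f0 fE.
    rewrite mesh_cat fr' /= lr'; elim: (N - _)%N => //= k.
    by rewrite mdistxx ltW.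
  apply: (conjugate_trans Esym cr); apply: (conjugate_trans Esym cr').
  apply: (homotopic_conjugate); first by split.
  exact: homotopic_pad.
have cK : compact (mesh_loops x0 p0 N).
  apply: (@subclosed_compact _ _ [set f : {ptws nat -> X} | forall i, [set: X] (f i)]) => //.
  - exact: closed_mesh_loops.
  - exact: (@tychonoff nat (fun=> X) (fun=> setT)).
have [f0 Kf0 lef0] := realize y0 q0 fq0 cq0 (lexx _).
have K0 : mesh_loops x0 p0 N !=set0 by exists f0.
have [f] := compact_EVT_min K0 cK (continuous_subspaceT (chain_length_continuous (N := N))).
move=> /set_mem Kf minf; exists (f 0%N), (tail N f); case: (Kf) => ff cf; split=> //.
(* Competitors longer than [M] lose to [f0], which realizes the initial loop. *)
move=> z r fr cr; have [le_M|lt_M] := leP (chain_length z r) M.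
  have [g Kg leg] := realize z r fr cr le_M.
  by apply: le_trans leg; apply: minf; apply/mem_set.
apply: le_trans (ltW lt_M); apply: le_trans lef0.
by apply: minf; apply/mem_set.
Qed.

End MinimalLoop.

(** * Partitions and subdivisions of curves *)

Section Curves.
Context {R : realType} {X : metricType R}.
Implicit Types (x y z : X) (p q : seq X) (c g : R -> X) (a b s t u v : R) (ts us : seq R).

(** An epsilon-delta form on an arbitrary interval, so that it restricts to the pieces of a
    partition. *)
Definition continuous_on c a b : Prop := forall s, a <= s <= b ->
  forall mu, 0 < mu -> exists2 r : R, 0 < r &
    forall t, a <= t <= b -> `|t - s| < r -> mdist (c s) (c t) < mu.

Lemma curve_continuous_on c : curve c -> continuous_on c 0 1.
Proof.
move=> cc s s01 mu mu0.
have As : `[0, 1]%classic s by rewrite /= in_itv.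
have b : nbhs (c s) (ball (c s) mu) by apply: nbhsx_ballx.
have := cc s _ b; rewrite /nbhs /= -nbhs_subspace_in //.
move=> [r /= r0 h]; exists r => // t t01 ts.
have := h t; rewrite /= ballEmdist; apply; last by rewrite in_itv.
by rewrite /ball_ /= distrC.
Qed.

Lemma continuous_on_sub c a b a' b' : a <= a' -> b' <= b ->
  continuous_on c a b -> continuous_on c a' b'.
Proof.
move=> aa' bb' cc s /andP[as_ sb] mu /(cc s _)[|r r0 h].
  by rewrite (le_trans aa' as_) (le_trans sb bb').
exists r => // t /andP[at_ tb]; apply: h.
by rewrite (le_trans aa' at_) (le_trans tb bb').
Qed.

Lemma lipschitz_continuous_on c a b K : 0 <= K ->
  (forall s t, mdist (c s) (c t) <= K * `|s - t|) -> continuous_on c a b.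
Proof.
move=> K0 lip s _ mu mu0; have K1 : 0 < K + 1 by lra.
exists (mu / (K + 1)); first by rewrite divr_gt0.
move=> t _; rewrite ltr_pdivlMr // => st; apply: le_lt_trans (lip s t) _.
rewrite distrC; apply: le_lt_trans st; rewrite mulrC ler_wpM2l //; lra.
Qed.

(** The condition concerns all pairs of points over an interval, not only comparisons with its ends,
    and is therefore inherited by refinements. [P] will be a distance bound or membership in [E]. *)
Definition osc_partition (P : X -> X -> Prop) c a ts : bool :=
  path (fun s t => `[< s < t /\
    forall u v, s <= u <= t -> s <= v <= t -> P (c u) (c v) >]) a ts.

Lemma osc_cons P c a t ts : osc_partition P c a (t :: ts) <->
  [/\ a < t, forall u v, a <= u <= t -> a <= v <= t -> P (c u) (c v) &
      osc_partition P c t ts].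
Proof.
by rewrite /osc_partition /=; split=> [/andP[/asboolP[at_ h] ->]|[at_ h ->]] //;
  rewrite andbT; apply/asboolP.
Qed.

Lemma osc_cat P c a ts us : osc_partition P c a (ts ++ us) =
  osc_partition P c a ts && osc_partition P c (last a ts) us.
Proof. exact: cat_path. Qed.

Lemma osc_lt P c a ts : osc_partition P c a ts -> path <%R a ts.
Proof. by apply: sub_path => s t /asboolP[]. Qed.

Lemma path_le_last a ts : path <=%R a ts -> a <= last a ts.
Proof.
elim: ts a => [|t ts ih] a //= /andP[at_ /ih]; exact: le_trans.
Qed.

Lemma path_le_mem a ts t : path <=%R a ts -> t \in a :: ts -> a <= t <= last a ts.
Proof.
elim: ts a => [|u ts ih] a; first by rewrite inE => _ /eqP ->; rewrite lexx.
move=> ats; have al := path_le_last ats; move: ats => /= /andP[au uts].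
rewrite in_cons => /orP[/eqP ->|/(ih _ uts)/andP[ut ->]]; first by rewrite lexx.
by rewrite (le_trans au ut).
Qed.

Lemma osc_le P c a ts : osc_partition P c a ts -> a <= last a ts.
Proof.
by move=> /osc_lt h; apply: path_le_last; apply: sub_path h => s t /ltW.
Qed.

Lemma osc_weaken (P Q : X -> X -> Prop) c a ts : (forall x y, P x y -> Q x y) ->
  osc_partition P c a ts -> osc_partition Q c a ts.
Proof.
move=> PQ; apply: sub_path => s t /asboolP[st h]; apply/asboolP; split=> //.
by move=> u v su sv; apply/PQ/h.
Qed.

Lemma osc_mesh mu c a ts : osc_partition (fun x y => mdist x y <= mu) c a ts ->
  mesh_le mu (c a) (map c ts).
Proof.
rewrite /mesh_le path_map; apply: sub_path => s t /asboolP[st h] /=.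
by apply: h; rewrite lexx ltW.
Qed.

Lemma osc_chain (E : set (X * X)) c a ts :
  osc_partition (fun x y => E (x, y)) c a ts -> chain E (c a) (map c ts).
Proof.
rewrite /chain path_map; apply: sub_path => s t /asboolP[st h] /=.
by apply/mem_set/h; rewrite lexx ltW.
Qed.

(** The supremum [s] of the endpoints that can be reached must be [b]: continuity at [s] allows one
    more interval, reaching beyond [s] unless [b] comes first. *)
Lemma osc_partition_exists mu c a b : a <= b -> 0 < mu -> continuous_on c a b ->
  exists ts, osc_partition (fun x y => mdist x y <= mu) c a ts /\ last a ts = b.
Proof.
move=> ab mu0 cc; set P := fun x y => _.
pose S := [set t | t <= b /\ exists ts, osc_partition P c a ts /\ last a ts = t].
have Sa : S a by split=> //; exists [::].
have ubS : ubound S b by move=> t [].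
have supS : has_sup S by split; [exists a|exists b].
set s := sup S.
have as_ : a <= s by apply: sup_upper_bound.
have sb : s <= b by apply: ge_sup => //; exists a.
have s_ab : a <= s <= b by rewrite as_ sb.
have mu20 : 0 < mu / 2 by rewrite divr_gt0.
have [r r0 h] := cc s s_ab _ mu20.
have r20 : 0 < r / 2 by rewrite divr_gt0.
have [t [tb [ts [ots tsE]]] st] := sup_adherent r20 supS.
rewrite -/s in st; have ts_ : t <= s by apply: sup_upper_bound => //; split=> //; exists ts.
have at_ : a <= t by rewrite -tsE; apply: osc_le ots.
(* Both [t] and [t'] are within [r / 2] of [s] when [t < t'], so any two values of [c] on the new
   interval are within [mu / 2] of [c s]. *)
set t' := Num.min b (s + r / 2).
have t'b : t' <= b by rewrite ge_min lexx.
have [tt'|t't] := ltP t t'.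
  have ot' : osc_partition P c a (ts ++ [:: t']).
    rewrite osc_cat ots tsE andTb; apply/osc_cons; split=> // u v /andP[tu ut] /andP[tv vt].
    have ? : t' <= s + r / 2 by rewrite ge_min lexx orbT.
    have hu : mdist (c s) (c u) < mu / 2.
      apply: h; first by apply/andP; split; lra.
      by rewrite ltr_norml; apply/andP; split; lra.
    have hv : mdist (c s) (c v) < mu / 2.
      apply: h; first by apply/andP; split; lra.
      by rewrite ltr_norml; apply/andP; split; lra.
    rewrite metric_sym in hu; rewrite /P; have := metric_triangle (c u) (c s) (c v); lra.
  exists (ts ++ [:: t']); split=> //; rewrite last_cat /=.
  have : t' <= s.
    by apply: sup_upper_bound => //; split=> //; exists (ts ++ [:: t']); rewrite last_cat.
  by rewrite /t'; case: (ltP b (s + r / 2)) => //= _; lra.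
exists ts; split=> //; rewrite tsE; apply/eqP; rewrite eq_le tb /=.
by move: t't; rewrite /t'; case: (ltP b (s + r / 2)) => //= _; lra.
Qed.

(** * Comparing subdivisions of one curve *)

Section Subdivisions.
Context (E : set (X * X)) (eps : R).
Hypothesis eps0 : 0 < eps.
Hypothesis epsE : metric_entourage eps `<=` E.
Hypothesis Esym : forall x y, E (x, y) -> E (y, x).
Let Erefl : forall x, E (x, x) := sub_entourage_refl eps0 epsE.
Local Notation Erel := (fun x y => E (x, y)).

(** Suppose [t], the first point of [ts], comes before [u], the first point of [us]. The condition
    on the interval from [a] to [u] passes to both parts, so [t] may be inserted into [us], and the
    induction on the total size continues from [t]. *)
Lemma osc_homotopic c a ts us : osc_partition Erel c a ts ->
  osc_partition Erel c a us -> last a ts = last a us ->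
  homotopic E (c a) (map c ts) (map c us).
Proof.
have [n] := ubnP (size ts + size us); elim: n a ts us => // n ih a ts us.
wlog : ts us / head a ts <= head a us => [wl szn ots ous l|].
  have [le|/ltW le] := leP (head a ts) (head a us); first exact: wl.
  by apply/homotopic_sym/wl => //; rewrite addnC.
case: ts us => [|t ts] [|u us] /=.
- by move=> _ _ _ _ _; apply: homotopic_refl.
- by move=> _ _ _ /osc_cons[au _ /osc_le] + e; rewrite -e; lra.
- by move=> _ _ /osc_cons[au _ /osc_le] + _ e; rewrite e; lra.
move=> tu szn /osc_cons[at_ ht ots] /osc_cons[au hu ous] l.
have ct : E (c a, c t) by apply: ht; rewrite lexx ltW.
move: au hu ous l tu szn; have [<- _ _ ous l _ szn|ntu au hu ous l tu szn] := eqVneq t u.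
  apply: homotopic_cons => //; apply: ih => //.
  by move: szn => /=; lia.
have {}tu : t < u by rewrite lt_neqAle ntu.
have ctu : E (c t, c u) by apply: hu; apply/andP; split; lra.
have cau : E (c a, c u) by apply: hu; rewrite lexx ltW.
apply: (@homotopic_trans _ _ _ _ _ (map c [:: t, u & us])).
  apply: homotopic_cons => //; apply: (ih t ts (u :: us)) => //.
    by apply/osc_cons; split=> // v w ? ?; apply: hu; lra.
by apply: homotopic_remove => //; apply: osc_chain.
Qed.

(** Each interval of the subdivision is partitioned finely. All points over it are [E]-close to the
    value at its right end, so the fine piece is a fan and contracts to the original step. *)
Lemma subdivision_osc c a b ts : continuous_on c a b ->
  path (fun s t => `[< s <= t /\
    c @` `[s, t] `<=` xsection E (c s) `&` xsection E (c t) >]) a ts ->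
  last a ts = b ->
  exists us, [/\ osc_partition Erel c a us, last a us = b &
                 homotopic E (c a) (map c ts) (map c us)].
Proof.
elim: ts a => [|t ts ih] a cc /=.
  by move=> _ ->; exists [::]; split=> //; apply: homotopic_refl.
move=> /andP[/asboolP[at_ sub] pts] l.
have tb : t <= b.
  by rewrite -l; apply: path_le_last; apply: sub_path pts => u v /asboolP[].
have [us [ous lus hus]] := ih t (continuous_on_sub at_ (lexx b) cc) pts l.
have e20 : 0 < eps / 2 by rewrite divr_gt0.
have [vs [ovs lvs]] := osc_partition_exists at_ e20 (continuous_on_sub (lexx a) tb cc).
have {}ovs : osc_partition Erel c a vs.
  apply: osc_weaken ovs => x y xy; apply: epsE; apply: le_lt_trans xy _ => /=; lra.
exists (vs ++ us); rewrite osc_cat ovs lvs last_cat lvs; split=> //.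
have lc : last (c a) (map c vs) = c t by rewrite last_map lvs.
rewrite map_cat -cat1s; apply: homotopic_cat2 => //.
apply: homotopic_sym; rewrite -lc; apply: (homotopic_fan Erefl); first exact: osc_chain.
move=> z; rewrite lc -map_cons => /mapP[v vvs ->].
have : (c @` `[a, t]) (c v).
  exists v => //=; rewrite in_itv /= -lvs; apply: path_le_mem vvs.
  by apply: sub_path (osc_lt ovs) => x y /ltW.
move=> /sub[_]; rewrite /xsection /= inE; exact: Esym.
Qed.

End Subdivisions.
End Curves.

(** * Lengths and geodesics *)

Section Length.
Context {R : realType} {X : metricType R}.
Implicit Types (x y z : X) (p q : seq X) (c g : R -> X) (a b s t u v : R) (ts us : seq R).

Lemma chord_lengthE c s t ts :
  chord_length c s t ts = chain_length (c s) (map c ts).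
Proof.
rewrite /chord_length; elim: ts s => [|u ts ih] s /=; first by rewrite big_nil.
by rewrite big_nat_recl //= -ih.
Qed.

Lemma curve_length_strict c a b ts : path <%R a ts -> last a ts = b ->
  ((chain_length (c a) (map c ts))%:E <= curve_length c a b)%E.
Proof.
move=> ats lts; apply: ereal_sup_ubound; exists ts; last by rewrite chord_lengthE.
by split=> //; apply/eqP.
Qed.

(** Partitions in [itv_partition] are strict; repeated points give chords of length zero and are
    dropped. *)
Lemma curve_length_weak c a b ts : path <=%R a ts -> last a ts = b ->
  ((chain_length (c a) (map c ts))%:E <= curve_length c a b)%E.
Proof.
move=> ats lts.
suff [us [aus lus ->]] : exists us, [/\ path <%R a us, last a us = b &
    chain_length (c a) (map c ts) = chain_length (c a) (map c us)].
  exact: curve_length_strict.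
elim: ts a ats lts => [|t ts ih] a /=; first by exists [::].
move=> /andP[at_ /ih tts] /tts[us [tus lus e]].
have [->|nat_] := eqVneq a t; first by exists us; rewrite mdistxx add0r.
by exists (t :: us); rewrite /= tus lt_neqAle nat_ at_ e.
Qed.

Lemma curve_length_ge0 c a b : a <= b -> (0 <= curve_length c a b)%E.
Proof.
move=> ab; have := @curve_length_weak c a b [:: b].
rewrite /= ab addr0 => /(_ isT erefl); apply: le_trans.
by rewrite lee_fin mdist_ge0.
Qed.

Lemma mdist_le_curve_length c a b : a <= b ->
  ((mdist (c a) (c b))%:E <= curve_length c a b)%E.
Proof.
by move=> ab; have := @curve_length_weak c a b [:: b]; rewrite /= ab addr0; apply.
Qed.

Lemma curve_length_le c a b (M : \bar R) :
  (forall ts, path <%R a ts -> last a ts = b ->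
     ((chain_length (c a) (map c ts))%:E <= M)%E) ->
  (curve_length c a b <= M)%E.
Proof.
move=> h; apply: ge_ereal_sup => _ [ts [ats /eqP lts] <-].
by rewrite chord_lengthE; apply: h.
Qed.

Lemma lt_curve_length c a b (r : R) : (r%:E < curve_length c a b)%E ->
  exists ts, [/\ path <%R a ts, last a ts = b & r < chain_length (c a) (map c ts)].
Proof.
move=> /ereal_sup_gt[_ [ts [ats /eqP lts] <-]].
by rewrite chord_lengthE lte_fin; exists ts.
Qed.

Lemma lipschitz_chain_length g (K : R) a ts :
  (forall s t, mdist (g s) (g t) <= K * `|s - t|) -> path <=%R a ts ->
  chain_length (g a) (map g ts) <= K * (last a ts - a).
Proof.
move=> lip; elim: ts a => [|t ts ih] a /=; first by rewrite subrr mulr0.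
move=> /andP[at_ /ih]; have := lip a t; rewrite distrC ger0_norm ?subr_ge0 //; lra.
Qed.

Lemma lipschitz_curve g (K : R) :
  (forall s t, mdist (g s) (g t) <= K * `|s - t|) -> curve g.
Proof.
move=> lip; apply: continuous_subspaceT => s; apply/cvg_ballP => e e0.
have K1 : 0 < `|K| + 1 by rewrite ltr_wpDl.
have d0 : 0 < e / (`|K| + 1) by rewrite divr_gt0.
have [b] : nbhs s (ball s (e / (`|K| + 1))) by apply: nbhsx_ballx.
move=> b0 sb; exists b => // t /sb; rewrite ballEmdist /=.
rewrite /ball /= ltr_pdivlMr // => st; apply: le_lt_trans (lip s t) _.
apply: le_lt_trans st; rewrite mulrC ler_wpM2l //.
by have := ler_norm K; lra.
Qed.

(* Along a curve of length d(x, y), the distance to x is an arclength parameter. *)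
Lemma geodesic_lipschitz : geodesic_space X -> forall x y, exists g : R -> X,
  [/\ g 0 = x, g (mdist x y) = y & forall s t, mdist (g s) (g t) <= `|s - t|].
Proof.
move=> geo x y; have [c [cc c0 c1 len]] := geo x y.
set D := mdist x y in len *; have D0 : 0 <= D := mdist_ge0 x y.
pose f t := mdist x (c t).
(* Against the triangle inequality [D <= f t + mdist (c t) y], this bounds [mdist (c s) (c t)] by
   [f t - f s]. *)
have split_at s t : 0 <= s -> s <= t -> t <= 1 ->
    f s + mdist (c s) (c t) + mdist (c t) y <= D.
  move=> s0 st t1; have := @curve_length_weak c 0 1 [:: s; t; 1].
  rewrite /= s0 st t1 len lee_fin c0 c1 => /(_ isT erefl); rewrite /f; lra.
have dist_f s t : 0 <= s <= 1 -> 0 <= t <= 1 -> mdist (c s) (c t) <= `|f s - f t|.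
  wlog st : s t / s <= t => [wl s01 t01|/andP[s0 s1] /andP[t0 t1]].
    have [st|/ltW ts] := leP s t; first exact: wl.
    by rewrite metric_sym distrC; apply: wl.
  have := split_at s t s0 st t1; have := metric_triangle x (c t) y.
  rewrite -/D -/(f t) => h1 h2; rewrite distrC; apply: le_trans (ler_norm _); lra.
have fcont : {within `[0, 1], continuous f}.
  move=> s; apply: (cvg_comp c (mdist x) (cc s)).
  apply/cvgrPdist_lt => e e0.
  have b : nbhs (c s) (ball (c s) e) by apply: nbhsx_ballx.
  apply: filterS b => z; rewrite ballEmdist /= => sz.
  change (`|mdist x (c s) - mdist x z| < e).
  have := metric_triangle x (c s) z; have := metric_triangle x z (c s).
  rewrite (metric_sym z) => h1 h2; rewrite ltr_norml; apply/andP; split; lra.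
have f0 : f 0 = 0 by rewrite /f c0 mdistxx.
have f1 : f 1 = D by rewrite /f c1.
(* The parameter [u] is clamped to the range from [0] to [D], which makes the new curve Lipschitz on
   the whole line; the time [t] comes from the intermediate value theorem. *)
have param u : exists t, 0 <= t <= 1 /\ f t = Num.max 0 (Num.min u D).
  have hv : Num.min (f 0) (f 1) <= Num.max 0 (Num.min u D) <= Num.max (f 0) (f 1).
    rewrite f0 f1 (min_idPl D0) (max_idPr D0) le_max lexx /=.
    by rewrite ge_max D0 ge_min lexx orbT.
  have [t] := IVT ler01 fcont hv.
  by rewrite in_itv /= => t01 ft; exists t.
have [tau tauP] := boolp.choice param.
have clamp u v : `|Num.max 0 (Num.min u D) - Num.max 0 (Num.min v D)| <= `|u - v|.
  wlog uv : u v / u <= v => [wl|].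
    by have [/wl//|/ltW/wl] := leP u v; rewrite distrC (distrC v).
  rewrite (distrC u) (ger0_norm (_ : 0 <= v - u)) ?subr_ge0 // ler_norml.
  case: (leP u D) => uD; case: (leP v D) => vD; case: (leP 0 u) => u0;
    case: (leP 0 v) => v0; rewrite ?(max_idPr D0); apply/andP; split; lra.
have fixed u t : 0 <= t <= 1 -> f t = Num.max 0 (Num.min u D) -> 
    c (tau u) = c t.
  move=> t01 ft; apply: mdist_positivity; apply/eqP; rewrite eq_le mdist_ge0 andbT.
  have [tu01 ftu] := tauP u; apply: le_trans (dist_f _ _ tu01 t01) _.
  by rewrite ft ftu subrr normr0.
exists (c \o tau); split=> [||s t] /=.
- rewrite -c0; apply: fixed; first by rewrite lexx ler01.
  by rewrite f0 (min_idPl D0) maxxx.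
- rewrite -c1; apply: fixed; first by rewrite lexx ler01.
  by rewrite f1 minxx (max_idPr D0).
- have [s01 fs] := tauP s; have [t01 ft] := tauP t.
  by apply: le_trans (dist_f _ _ s01 t01) _; rewrite fs ft.
Qed.

End Length.

(** * Polygonal curves *)

Section Realization.
Context {R : realType} {X : metricType R}.
Hypothesis geodesicX : geodesic_space X.
Implicit Types (x y z : X) (p q : seq X) (c g : R -> X) (a b s t u v : R) (ts us : seq R).

(** Geodesics are glued at unit speed. The list [ss] holds the parameters of the vertices; the last
    clause bounds lengths from below, as the Lipschitz bound does from above. *)
Lemma polygon mu x p : 0 <= mu -> mesh_le mu x p -> exists g : R -> X,
  [/\ g 0 = x,
      forall s t, mdist (g s) (g t) <= `|s - t|,
      exists ss, [/\ path (fun s t => s <= t <= s + mu) 0 ss,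
        last 0 ss = chain_length x p & map g ss = p] &
      forall u, 0 <= u <= chain_length x p -> exists ts,
        [/\ path <=%R 0 ts, last 0 ts = u & u <= chain_length x (map g ts)]].
Proof.
move=> mu0; elim: p x => [|y p ih] x /=.
  move=> _; exists (fun=> x); split=> //; first by move=> s t; rewrite mdistxx.
    by exists [::].
  by move=> u /andP[u0 u0']; exists [::]; split=> //; apply/eqP; rewrite eq_le u0 u0'.
move=> /andP[xy /ih[g [g0 lipg [ss [pss lss gss]] len]]].
have [h [h0 hD liph]] := geodesic_lipschitz geodesicX x y.
set D := mdist x y in xy hD *; have D0 : 0 <= D := mdist_ge0 x y.
(* The first geodesic [h] is followed by the polygon [g] of the remaining chain, delayed by [D]. *)
pose k u := if u <= D then h u else g (u - D).
have kD u : 0 <= u -> k (u + D) = g u.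
  move=> u0; rewrite /k addrK; case: ifP => // uD.
  have -> : u = 0 by apply/eqP; rewrite eq_le u0 andbT -(lerD2r D) add0r.
  by rewrite add0r hD g0.
have k0 : k 0 = x by rewrite /k D0 h0.
have kmap ts : path <=%R 0 ts -> map k (map (+%R^~ D) ts) = map g ts.
  move=> pts; rewrite -map_comp; apply/eq_in_map => t tts /=; apply: kD.
  by have /andP[] : 0 <= t <= last 0 ts by apply: path_le_mem => //; rewrite in_cons tts orbT.
have shift (e : rel R) ts : (forall s t, e (s + D) (t + D) = e s t) ->
    path e D (map (+%R^~ D) ts) = path e 0 ts.
  move=> eD; transitivity (path e (0 + D) (map (+%R^~ D) ts)); first by rewrite add0r.
  rewrite -[LHS]/(path e ((+%R^~ D) 0) (map (+%R^~ D) ts)) path_map.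
  by apply: eq_path => s t /=; apply: eD.
have lshift ts : last D (map (+%R^~ D) ts) = last 0 ts + D.
  by have := last_map (+%R^~ D) ts 0; rewrite /= add0r.
exists k; split=> //.
- move=> s t; wlog st : s t / s <= t => [wl|].
    by have [/wl//|/ltW/wl] := leP s t; rewrite metric_sym distrC.
  rewrite distrC ger0_norm ?subr_ge0 // /k.
  case: (leP t D) => tD.
    rewrite (le_trans st tD); apply: le_trans (liph s t) _.
    by rewrite distrC ger0_norm ?subr_ge0.
  case: (leP s D) => sD.
    apply: le_trans (metric_triangle _ y _) _.
    have h1 := liph s D; have h2 := lipg 0 (t - D).
    rewrite hD distrC ger0_norm ?subr_ge0 // in h1.
    rewrite g0 distrC subr0 ger0_norm ?subr_ge0 ?(ltW tD) // in h2; lra.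
  apply: le_trans (lipg _ _) _; rewrite distrC ger0_norm; lra.
- exists (D :: map (+%R^~ D) ss); split=> /=.
  + rewrite D0 add0r xy /= shift // => s t; apply/idP/idP => /andP[? ?]; apply/andP; split; lra.
  + by rewrite lshift lss addrC.
  + rewrite kmap ?gss; last by apply: sub_path pss => s t /andP[].
    by have := kD 0 (lexx 0); rewrite add0r g0 => ->.
- move=> u /andP[u0 uL]; have [uD|Du] := leP u D.
    (* The chord from [x] to [h u] has length at least [u], since the rest of the way to [h D] is at
       most [D - u]. *)
    exists [:: u]; rewrite /= u0 addr0 /k uD; split=> //.
    have h1 := metric_triangle x (h u) (h D); have h2 := liph u D.
    rewrite distrC ger0_norm ?subr_ge0 // in h2; rewrite hD -/D in h1; rewrite hD in h2; lra.
  have [|ts [pts lts uts]] := len (u - D); first by apply/andP; split; lra.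
  exists (D :: map (+%R^~ D) ts); split=> /=.
  + by rewrite D0 shift // => s t; rewrite lerD2r.
  + by rewrite lshift lts subrK.
  + by rewrite kmap //; have := kD 0 (lexx 0); rewrite add0r g0 => ->; rewrite -/D; lra.
Qed.

Lemma polygonal_curve (E : set (X * X)) eps mu x p :
  metric_entourage eps `<=` E -> (forall x y, E (x, y) -> E (y, x)) ->
  0 <= mu -> mu < eps -> mesh_le mu x p -> exists c,
  [/\ curve c /\ c 0 = x, c 1 = last x p,
      forall t, 0 <= t <= 1 -> curve_length c 0 t = (t * chain_length x p)%:E &
      exists q, subdivision E c q /\ homotopic E x p q].
Proof.
move=> epsE Esym mu0 mueps xp.
have [g [g0 lipg [ss [pss lss gss]] len]] := polygon mu0 xp.
set L := chain_length x p in lss len *; have L0 : 0 <= L := chain_length_ge0 x p.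
pose c t := g (t * L).
have lipc s t : mdist (c s) (c t) <= L * `|s - t|.
  have -> : L * `|s - t| = `|s * L - t * L|.
    by rewrite -mulrBl normrM (ger0_norm L0) mulrC.
  exact: lipg.
have c0 : c 0 = x by rewrite /c mul0r.
have pscale (e : rel R) ts :
    path e 0 (map ( *%R^~ L^-1) ts) = path (fun s t => e (s / L) (t / L)) 0 ts.
  by have := @path_map _ _ ( *%R^~ L^-1) e 0 ts; rewrite /= mul0r.
have lscale ts : last 0 (map ( *%R^~ L^-1) ts) = last 0 ts / L.
  by have := last_map ( *%R^~ L^-1) ts 0; rewrite /= mul0r.
have c1 : c 1 = last x p by rewrite /c mul1r -lss -g0 -gss last_map.
exists c; split=> //; first by split=> //; apply: lipschitz_curve lipc.
- move=> t /andP[t0 t1]; apply/eqP; rewrite eq_le; apply/andP; split.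
    apply: curve_length_le => ts pts lts; rewrite lee_fin.
    have := lipschitz_chain_length lipc (sub_path (fun u v => @ltW _ _ u v) pts).
    by rewrite lts subr0 mulrC.
  have [L00|Ln0] := eqVneq L 0; first by rewrite L00 mulr0; apply: curve_length_ge0.
  have [|ts [pts lts uts]] := len (t * L).
    by rewrite mulr_ge0 //= ler_piMl.
  have LV0 : 0 <= L^-1 by rewrite invr_ge0.
  have := @curve_length_weak _ _ c 0 t (map ( *%R^~ L^-1) ts).
  have -> : map c (map ( *%R^~ L^-1) ts) = map g ts.
    by rewrite -map_comp; apply: eq_map => s /=; rewrite /c mulfVK.
  rewrite c0 lscale lts mulfK // => h.
  apply: le_trans (h _ erefl); first by rewrite lee_fin.
  by rewrite pscale; apply: sub_path pts => s v /= sv; rewrite ler_wpM2r.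
(* A subdivision must end at parameter [1], but the rescaled vertices end at [L / L], which is [0]
   when [L = 0]. Appending the parameter [1] repeats the last point and covers both cases. *)
- exists (p ++ nseq 1 (last x p)); split; last first.
    apply: homotopic_pad; last exact: (mesh_chain epsE mueps).
    by apply: sub_entourage_refl epsE; apply: le_lt_trans mu0 mueps.
  pose Q s t := `[< s <= t /\ c @` `[s, t] `<=` xsection E (c s) `&` xsection E (c t) >].
  have Qst s t : s <= t -> t * L - s * L <= mu -> Q s t.
    move=> st stmu; apply/asboolP; split=> // y [w /=].
    rewrite in_itv /= => /andP[sw wt] <-.
    have swL : s * L <= w * L by rewrite ler_wpM2r.
    have wtL : w * L <= t * L by rewrite ler_wpM2r.
    split; rewrite /xsection /= inE; apply: epsE; rewrite /metric_entourage /=;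
      apply: le_lt_trans (lipg _ _) _; [rewrite distrC|]; rewrite ger0_norm; lra.
  (* If [L = 0] then [s = 0], and the identity holds for the conventional inverse of zero. *)
  have divK s : 0 <= s <= L -> s / L * L = s.
    move=> /andP[s0 sL]; have [L00|Ln0] := eqVneq L 0; last by rewrite mulfVK.
    by rewrite L00 mulr0; lra.
  have bnd s : s \in 0 :: ss -> 0 <= s <= L.
    by move=> sss; rewrite -lss; apply: path_le_mem sss; apply: sub_path pss => u v /andP[].
  exists (map ( *%R^~ L^-1) ss ++ [:: 1]); split.
  + have LV0 : 0 <= L^-1 by rewrite invr_ge0.
    have lss' : last 0 (map ( *%R^~ L^-1) ss) = L / L.
      by rewrite lscale lss.
    rewrite cat_path lss' /=; apply/and3P; split=> //; last first.
      apply: Qst; last by rewrite divK ?lexx ?L0 // mul1r subrr.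
      by have [->|Ln0] := eqVneq L 0; rewrite ?mul0r ?divff.
    rewrite pscale.
    apply: (@sub_in_path _ (mem (0 :: ss))) pss; last by apply/allP.
    move=> s t /bnd sL /bnd tL /= /andP[st tmu].
    apply: Qst; first by rewrite ler_wpM2r.
    by rewrite !divK //; lra.
  + by rewrite last_cat.
  + rewrite map_cat /= c1; congr (_ ++ _); rewrite -[LHS]gss -map_comp.
    apply/eq_in_map => s sss /=; rewrite /c divK //.
    by apply: bnd; rewrite in_cons sss orbT.
Qed.

End Realization.

(** * Shortest curves in a free class *)

Section FreeClass.
Context {R : realType} {X : metricType R} (E : set (X * X)) (eps : R).
Hypothesis eps0 : 0 < eps.
Hypothesis epsE : metric_entourage eps `<=` E.
Hypothesis Esym : forall x y, E (x, y) -> E (y, x).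
Hypothesis geodesicX : geodesic_space X.
Implicit Types (x y z : X) (p q : seq X) (c : R -> X) (ts us : seq R).

Let Erefl : forall x, E (x, x) := sub_entourage_refl eps0 epsE.
Local Notation Erel := (fun x y => E (x, y)).

Lemma osc_subdivision c ts : osc_partition Erel c 0 ts -> last 0 ts = 1 ->
  subdivision E c (map c ts).
Proof.
move=> ots lts; exists ts; split=> //; apply: sub_path ots => s t /asboolP[st h].
apply/asboolP; split; first exact: ltW.
move=> y [w /=]; rewrite in_itv /= => swt <-.
have sst : s <= s <= t by rewrite lexx ltW.
have stt : s <= t <= t by rewrite lexx ltW.
by split; rewrite /xsection /= inE; apply: h.
Qed.

Lemma subdivision_chain c p : curve c -> subdivision E c p ->
  chain E (c 0) p /\ last (c 0) p = c 1.
Proof.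
move=> cc [ts [pts lts ->]]; split; last by rewrite last_map lts.
have [us [_ _ h]] := subdivision_osc eps0 epsE Esym (curve_continuous_on cc) pts lts.
exact: (homotopic_chain h).1.
Qed.

Lemma subdivision_loop c p : closed_curve c -> subdivision E c p -> loop E (c 0) p.
Proof. by move=> [cc c01] /(subdivision_chain cc)[cp lp]; split=> //; rewrite lp. Qed.

(** Both subdivisions pass to partitions with oscillation in [E], which are homotopic to each
    other. *)
Lemma subdivision_homotopic c p q : curve c ->
  subdivision E c p -> subdivision E c q -> homotopic E (c 0) p q.
Proof.
move=> /curve_continuous_on cc [ts [pts lts ->]] [us [pus lus ->]].
have [ts' [ots lts' h]] := subdivision_osc eps0 epsE Esym cc pts lts.
have [us' [ous lus' h']] := subdivision_osc eps0 epsE Esym cc pus lus.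
apply: (homotopic_trans h); apply: homotopic_trans (homotopic_sym h').
by apply: osc_homotopic => //; rewrite lts' lus'.
Qed.

Lemma mesh_osc mu c a ts : mu < eps ->
  osc_partition (fun x y => mdist x y <= mu) c a ts -> osc_partition Erel c a ts.
Proof.
by move=> lt_mu; apply: osc_weaken => x y xy; apply: epsE; apply: le_lt_trans xy lt_mu.
Qed.

Lemma fine_subdivision mu c : curve c -> 0 < mu -> mu < eps -> exists p,
  [/\ subdivision E c p, mesh_le mu (c 0) p &
      ((chain_length (c 0) p)%:E <= curve_length c 0 1)%E].
Proof.
move=> /curve_continuous_on cc mu0 lt_mu.
have [ts [ots lts]] := osc_partition_exists ler01 mu0 cc.
exists (map c ts); split; [|exact: osc_mesh|].
  by apply: osc_subdivision lts; apply: mesh_osc ots.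
exact: curve_length_strict (osc_lt ots) lts.
Qed.

(** The definition asks for some pair of subdivisions; this permits any pair chosen in advance. *)
Lemma freely_homotopic_curves_conjugate c c' p q : closed_curve c -> closed_curve c' ->
  subdivision E c p -> subdivision E c' q ->
  freely_homotopic_curves E c c' <-> conjugate E (c 0) p (c' 0) q.
Proof.
move=> cc cc' sp sq; split; last by exists p, q; split=> //; apply/freely_homotopicP.
move=> [p' [q' [sp' sq' /(freely_homotopicP Erefl Esym) h]]].
have hp := subdivision_homotopic cc.1 sp sp'.
have hq := subdivision_homotopic cc'.1 sq' sq.
apply: (conjugate_trans Esym) (homotopic_conjugate (subdivision_loop cc sp) hp) _.
apply: (conjugate_trans Esym) h _.
exact: homotopic_conjugate (subdivision_loop cc' sq') hq.
Qed.

Lemma geodesic_chain mu x y : 0 < mu -> exists q,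
  [/\ mesh_le mu x q, last x q = y & chain_length x q <= mdist x y].
Proof.
move=> mu0; have [g [g0 gD lip]] := geodesic_lipschitz geodesicX x y.
have {}lip s t : mdist (g s) (g t) <= 1 * `|s - t| by rewrite mul1r.
have [ts [ots lts]] := osc_partition_exists (mdist_ge0 x y) mu0
  (lipschitz_continuous_on ler01 lip).
exists (map g ts); rewrite -{1 2 3}g0; split; first exact: osc_mesh.
  by rewrite last_map lts.
have := lipschitz_chain_length lip (sub_path (fun u v => @ltW _ _ u v) (osc_lt ots)).
by rewrite lts mul1r subr0.
Qed.

(** Going along [p] and back along [q] is a short loop, hence null. *)
Lemma homotopic_shortcut mu x p q : mesh_le mu x p -> mesh_le mu x q ->
  last x p = last x q -> mu < eps ->
  chain_length x p + chain_length x q + 2 * mu < 3 * eps -> homotopic E x p q.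
Proof.
move=> xp xq pq lt_mu len.
have cp := mesh_chain epsE lt_mu xp; have cq := mesh_chain epsE lt_mu xq.
have null : homotopic E x (p ++ reversal x q) [::].
  apply: (short_loop_null eps0 epsE Esym) lt_mu _ _.
  - by rewrite mesh_cat xp pq; apply: mesh_reversal.
  - by rewrite last_cat pq last_reversal.
  - by rewrite chain_length_cat pq chain_length_reversal.
apply: (@homotopic_trans _ _ _ _ _ (p ++ reversal x q ++ q)).
  rewrite -{1}[p]cats0; apply: homotopic_catl => //; rewrite pq.
  exact/homotopic_sym/reversal_homotopic.
rewrite catA; apply: (@homotopic_catr _ _ _ _ _ _ [::]) null _.
by rewrite last_cat pq last_reversal.
Qed.

(** * Existence of shortest curves, and when they are constant *)

Section Shortest.
Context (c : R -> X) (p0 : seq X).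
Hypothesis closed_c : closed_curve c.
Hypothesis sub_p0 : subdivision E c p0.

Lemma loop_in_free_class mu y q : 0 <= mu -> mu < eps -> mesh_le mu y q ->
  conjugate E (c 0) p0 y q -> exists cb, in_free_class E c cb /\
    forall t, 0 <= t <= 1 -> curve_length cb 0 t = (t * chain_length y q)%:E.
Proof.
move=> mu0 lt_mu yq cq; have lq : loop E y q by case: cq.
have [cb [[ccb cb0] cb1 len [q' [sq' qq']]]] :=
  polygonal_curve geodesicX epsE Esym mu0 lt_mu yq.
exists cb; split=> //.
have clb : closed_curve cb by split=> //; rewrite cb1 cb0 lq.2.
split=> //; apply/(freely_homotopic_curves_conjugate closed_c clb sub_p0 sq').
by rewrite cb0; apply: (conjugate_trans Esym) cq (homotopic_conjugate lq qq').
Qed.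

(** The loop is realized by a polygonal curve of the same length in the class, with which [cb]
    competes. *)
Lemma shortest_le_chain_length cb mu y q : shortest_in_free_class E c cb ->
  0 <= mu -> mu < eps -> mesh_le mu y q -> conjugate E (c 0) p0 y q ->
  (curve_length cb 0 1 <= (chain_length y q)%:E)%E.
Proof.
move=> [_ min] mu0 lt_mu yq cq.
have [c' [/min le_c' len]] := loop_in_free_class mu0 lt_mu yq cq.
by rewrite -[chain_length y q]mul1r -len // ler01 lexx.
Qed.

Lemma exists_shortest : compact [set: X] ->
  exists cb, shortest_in_free_class E c cb /\ proportional_to_arclength cb.
Proof.
move=> compactX; have e20 : 0 < eps / 2 by rewrite divr_gt0.
have e2 : eps / 2 < eps by lra.
have [p1 [sp1 mp1 _]] := fine_subdivision closed_c.1 e20 e2.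
have cp1 : conjugate E (c 0) p0 (c 0) p1.
  apply: homotopic_conjugate; first exact: subdivision_loop.
  exact: subdivision_homotopic closed_c.1 sub_p0 sp1.
have [|y [q [yq cq min]]] := minimal_loop e20 e2 epsE Esym compactX (x0 := c 0) (p0 := p0).
  by exists (c 0), p1.
have [cb [cbc len]] := loop_in_free_class (ltW e20) e2 yq cq.
exists cb; split; last by exists (chain_length y q) => t; rewrite in_itv /=; apply: len.
split=> // c' [clc' fc']; rewrite len ?ler01 ?lexx // mul1r.
have [q' [sq' mq' le_q']] := fine_subdivision clc'.1 e20 e2.
apply: le_trans le_q'; rewrite lee_fin; apply: min => //.
exact/(freely_homotopic_curves_conjugate closed_c clc' sub_p0 sq').
Qed.

(** The one-point loop lies in the class, so [cb] has length zero. *)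
Lemma null_shortest_constant cb : null_curve E c ->
  shortest_in_free_class E c cb -> ~ nonconstant cb.
Proof.
move=> [p [sp [lp p0']]] scb [s [t [s01 t01]]]; apply.
have null0 : homotopic E (c 0) p0 [::].
  exact: homotopic_trans (subdivision_homotopic closed_c.1 sub_p0 sp) p0'.
have le0 : (curve_length cb 0 1 <= 0)%E.
  apply: (shortest_le_chain_length (y := c 0) (q := [::]) scb (lexx 0) eps0) => //.
  by apply: homotopic_conjugate null0; apply: subdivision_loop.
wlog st : s t s01 t01 / s <= t => [wl|].
  by have [/wl|/ltW/wl] := leP s t; [apply|move=> h; apply/esym/h].
move: s01 t01; rewrite !in_itv /= => /andP[s0 s1] /andP[t0 t1].
have := @curve_length_weak _ _ cb 0 1 [:: s; t; 1].
rewrite /= s0 st t1 => /(_ isT erefl) h; have := le_trans h le0; rewrite lee_fin addr0.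
have h1 := mdist_ge0 (cb 0) (cb s); have h2 := mdist_ge0 (cb t) (cb 1).
have h3 := mdist_ge0 (cb s) (cb t).
by move=> h4; apply: mdist_positivity; lra.
Qed.

(** A constant curve has a one-step subdivision, which is null, and conjugates of null loops are
    null. *)
Lemma constant_null_curve cb : in_free_class E c cb -> ~ nonconstant cb ->
  null_curve E c.
Proof.
move=> [clcb fcb] const; exists p0; split=> //; split; first exact: subdivision_loop.
have cst t : 0 <= t <= 1 -> cb t = cb 0.
  move=> t01; apply: contrapT => t0; apply: const; exists t, 0.
  by rewrite !in_itv /= t01 lexx ler01.
have sub1 : subdivision E cb [:: cb 1].
  exists [:: 1]; split=> //=; rewrite andbT; apply/asboolP; split=> // y [w /=].
  rewrite in_itv /= => /cst -> <-.
  by split; rewrite /xsection /= inE ?clcb.2; rewrite -?clcb.2; apply: Erefl.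
have := (freely_homotopic_curves_conjugate closed_c clcb sub_p0 sub1).1 fcb.
move=> /(conjugate_null Erefl Esym); apply; rewrite -clcb.2.
exact: homotopic_repeat.
Qed.

Lemma nonconstant_shortest cb : shortest_in_free_class E c cb ->
  nonconstant cb <-> essential E /\ ~ null_curve E c.
Proof.
move=> scb; split=> [nc|[_ nn]]; last first.
  by apply: contrapT => /(constant_null_curve scb.1).
have nn : ~ null_curve E c by move=> /null_shortest_constant/(_ scb).
split=> //; exists (c 0), p0; split; first exact: subdivision_loop.
by move=> np; apply: nn; exists p0.
Qed.

(** * Minimizing arcs of a shortest curve *)

Section Arcs.
Context (cb : R -> X).
Hypothesis shortest_cb : shortest_in_free_class E c cb.

Let closed_cb : closed_curve cb := shortest_cb.1.1.
Let cont_cb : continuous_on cb 0 1 := curve_continuous_on closed_cb.1.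

Lemma inner_arc_minimizing s t : 0 <= s -> s <= t -> t <= 1 ->
  curve_length cb s t = (3 * eps / 2)%:E -> mdist (cb s) (cb t) = 3 * eps / 2.
Proof.
move=> s0 st t1 len; set d := mdist _ _; have eps_gt0 := eps0.
have led : d <= 3 * eps / 2 by rewrite -lee_fin -len mdist_le_curve_length.
apply/eqP; rewrite eq_le led leNgt /=; apply/negP => ltd.
(* Less than the whole deficit [3 * eps / 2 - d] is spent on [2 * mu], so the arc, the geodesic and
   [2 * mu] together stay below [3 * eps], as [homotopic_shortcut] demands. *)
pose mu := Num.min (eps / 2) ((3 * eps / 2 - d) / 3).
have mu0 : 0 < mu by rewrite lt_min; apply/andP; split; lra.
have mu1 : mu <= eps / 2 by rewrite ge_min lexx.
have mu2 : mu <= (3 * eps / 2 - d) / 3 by rewrite ge_min lexx orbT.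
have lt_mu : mu < eps by lra.
have osc a b : 0 <= a -> a <= b -> b <= 1 -> exists ts,
    osc_partition (fun x y => mdist x y <= mu) cb a ts /\ last a ts = b.
  by move=> a0 ab b1; apply: osc_partition_exists (continuous_on_sub a0 b1 cont_cb).
have [A [oA lA]] := osc 0 s (lexx 0) s0 (le_trans st t1).
have [B [oB lB]] := osc s t s0 st t1.
have [C [oC lC]] := osc t 1 (le_trans s0 st) t1 (lexx 1).
have [q [mq lq lenq]] := geodesic_chain (cb s) (cb t) mu0; rewrite -/d in lenq.
have mA := osc_mesh oA; have mB := osc_mesh oB; have mC := osc_mesh oC.
have cA : last (cb 0) (map cb A) = cb s by rewrite last_map lA.
have cB : last (cb s) (map cb B) = cb t by rewrite last_map lB.
have lenB : chain_length (cb s) (map cb B) <= 3 * eps / 2.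
  by rewrite -lee_fin -len; apply: curve_length_strict (osc_lt oB) lB.
have hB : homotopic E (cb s) (map cb B) q.
  by apply: (homotopic_shortcut mB mq) lt_mu _; rewrite ?lq //; lra.
have sub : subdivision E cb (map cb (A ++ B ++ C)).
  apply: osc_subdivision; last by rewrite !last_cat lA lB.
  by rewrite !osc_cat lA lB !(mesh_osc lt_mu).
have conj : conjugate E (c 0) p0 (cb 0) (map cb A ++ q ++ map cb C).
  apply: (conjugate_trans Esym).
    exact/(freely_homotopic_curves_conjugate closed_c closed_cb sub_p0 sub)/shortest_cb.1.2.
  apply: homotopic_conjugate; first exact: subdivision_loop closed_cb sub.
  rewrite !map_cat; apply: homotopic_cat hB (mesh_chain epsE lt_mu mA) cA _.
  by rewrite cB; apply: (mesh_chain epsE lt_mu).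
have mnew : mesh_le mu (cb 0) (map cb A ++ q ++ map cb C).
  by rewrite !mesh_cat mA cA mq lq mC.
have le1 := shortest_le_chain_length shortest_cb (ltW mu0) lt_mu mnew conj.
(* [B] was chosen for its mesh, and its chords might add up to only [d]. A second partition [B'] of
   the same arc has chords adding up to more than [d], which contradicts minimality. *)
have [|B' [pB' lB' lenB']] := @lt_curve_length _ _ cb s t d.
  by rewrite len lte_fin.
have le2 : ((chain_length (cb 0) (map cb (A ++ B' ++ C)))%:E <= curve_length cb 0 1)%E.
  apply: curve_length_strict; last by rewrite !last_cat lA lB'.
  by rewrite !cat_path (osc_lt oA) lA pB' lB' (osc_lt oC).
have := le_trans le2 le1; rewrite lee_fin !map_cat !chain_length_cat cA lq.
by rewrite last_map lB'; lra.
Qed.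

Lemma outer_arc_minimizing s t : 0 <= s -> s <= t -> t <= 1 ->
  (curve_length cb t 1 + curve_length cb 0 s)%E = (3 * eps / 2)%:E ->
  mdist (cb t) (cb s) = 3 * eps / 2.
Proof.
move=> s0 st t1; have t0 := le_trans s0 st; have s1 := le_trans st t1.
have eps_gt0 := eps0.
move: (curve_length_ge0 cb t1) (curve_length_ge0 cb s0).
have := @lt_curve_length _ _ cb t 1; have := @lt_curve_length _ _ cb 0 s.
have := mdist_le_curve_length cb t1; have := mdist_le_curve_length cb s0.
have lenC ts : path <%R t ts -> last t ts = 1 -> _ := @curve_length_strict _ _ cb t 1 ts.
have lenA ts : path <%R 0 ts -> last 0 ts = s -> _ := @curve_length_strict _ _ cb 0 s ts.
(* Both lengths are nonnegative and their sum is finite, so only finite values survive; the facts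
   about them were collected first in order to be rewritten along. *)
move: lenA lenC; case: (curve_length cb t 1) => [l| |]; case: (curve_length cb 0 s) => [l'| |] //=.
move=> lenA lenC d' d ltA ltC l0 l0' [len].
rewrite !lee_fin in d d' l0 l0'.
set D := mdist (cb t) (cb s).
have led : D <= 3 * eps / 2.
  have := metric_triangle (cb t) (cb 1) (cb s).
  by rewrite -[in mdist (cb 1) (cb s)]closed_cb.2 -/D; lra.
apply/eqP; rewrite eq_le led leNgt /=; apply/negP => ltd.
pose mu := Num.min (eps / 2) ((3 * eps / 2 - D) / 3).
have mu0 : 0 < mu by rewrite lt_min; apply/andP; split; lra.
have mu1 : mu <= eps / 2 by rewrite ge_min lexx.
have mu2 : mu <= (3 * eps / 2 - D) / 3 by rewrite ge_min lexx orbT.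
have lt_mu : mu < eps by lra.
have osc a b : 0 <= a -> a <= b -> b <= 1 -> exists ts,
    osc_partition (fun x y => mdist x y <= mu) cb a ts /\ last a ts = b.
  by move=> a0 ab b1; apply: osc_partition_exists (continuous_on_sub a0 b1 cont_cb).
have [A [oA lA]] := osc 0 s (lexx 0) s0 s1.
have [B [oB lB]] := osc s t s0 st t1.
have [C [oC lC]] := osc t 1 t0 t1 (lexx 1).
have [q [mq lq lenq]] := geodesic_chain (cb t) (cb s) mu0; rewrite -/D in lenq.
have mA := osc_mesh oA; have mB := osc_mesh oB; have mC := osc_mesh oC.
have cA : last (cb 0) (map cb A) = cb s by rewrite last_map lA.
have cB : last (cb s) (map cb B) = cb t by rewrite last_map lB.
have cC : last (cb t) (map cb C) = cb 0 by rewrite last_map lC closed_cb.2.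
have := lenA _ (osc_lt oA) lA; have := lenC _ (osc_lt oC) lC; rewrite !lee_fin => lenC' lenA'.
have hCA : homotopic E (cb t) (map cb C ++ map cb A) q.
  apply: (homotopic_shortcut _ mq) lt_mu _.
  - by rewrite mesh_cat mC cC.
  - by rewrite last_cat cC cA lq.
  - by rewrite chain_length_cat cC; lra.
have sub : subdivision E cb (map cb (A ++ B ++ C)).
  apply: osc_subdivision; last by rewrite !last_cat lA lB.
  by rewrite !osc_cat lA lB !(mesh_osc lt_mu).
have lsub := subdivision_loop closed_cb sub; rewrite map_cat in lsub.
(* Rotating the base point to [cb s] makes [C] followed by [A] a contiguous arc at the end of the
   loop, where it can be replaced by [q]. *)
have conj : conjugate E (c 0) p0 (cb s) (map cb B ++ q).
  apply: (conjugate_trans Esym).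
    exact/(freely_homotopic_curves_conjugate closed_c closed_cb sub_p0 sub)/shortest_cb.1.2.
  rewrite map_cat; have := conjugate_rotate Erefl Esym lsub; rewrite cA => rot.
  apply: (conjugate_trans Esym rot); apply: homotopic_conjugate; first by case: rot.
  rewrite map_cat -catA; apply: homotopic_catl; first by rewrite cB.
  exact: (mesh_chain epsE lt_mu).
have mnew : mesh_le mu (cb s) (map cb B ++ q) by rewrite mesh_cat mB cB.
have le1 := shortest_le_chain_length shortest_cb (ltW mu0) lt_mu mnew conj.
(* Each of the two partitions loses less than a third of the deficit [3 * eps / 2 - D], so their
   chords still add up to more than [D]. *)
have [|C' [pC' lC' lenC1]] := ltC (l - (3 * eps / 2 - D) / 3); first by rewrite lte_fin; lra.
have [|A' [pA' lA' lenA1]] := ltA (l' - (3 * eps / 2 - D) / 3); first by rewrite lte_fin; lra.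
have le2 : ((chain_length (cb 0) (map cb (A' ++ B ++ C')))%:E <= curve_length cb 0 1)%E.
  apply: curve_length_strict; last by rewrite !last_cat lA' lB.
  by rewrite !cat_path pA' lA' (osc_lt oB) lB.
have := le_trans le2 le1; rewrite lee_fin !map_cat !chain_length_cat !last_map lA' lB.
by move=> h; lra.
Qed.

Lemma shortest_closed_geodesic : closed_geodesic (3 * eps / 2) cb.
Proof.
split=> // s t s0 st t1; split; first exact: inner_arc_minimizing.
exact: outer_arc_minimizing.
Qed.

End Arcs.
End Shortest.

(** For each step of the chain, chainedness supplies a fine chain lying in the [E]-balls of both
    ends; it is a fan around the second end, hence homotopic to the step. *)
Lemma chained_refine mu x p : chained E -> 0 < mu -> mu < eps -> chain E x p ->
  exists q, mesh_le mu x q /\ homotopic E x p q.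
Proof.
move=> [_ _ refine] mu0 lt_mu; elim: p x => [|y p ih] x.
  by exists [::]; split=> //; apply: homotopic_refl.
move=> /chain_cons[xy /ih[q [yq pq]]].
have [|r [xr ry rE]] := refine x y (metric_entourage mu) xy.
  split; last by exists mu.
  by move=> u v; rewrite /metric_entourage /= metric_sym.
have mr : mesh_le mu x r.
  by apply: sub_path xr => u v /set_mem; rewrite /metric_entourage /= => /ltW.
have hr : homotopic E x r [:: last x r].
  apply: (homotopic_fan Erefl); first exact: (mesh_chain epsE lt_mu).
  by move=> z /rE[_]; rewrite ry /xsection /= inE; apply: Esym.
exists (r ++ q); rewrite mesh_cat mr ry yq; split=> //.
rewrite -cat1s; apply: (@homotopic_cat2 _ _ _ x [:: y]); last exact: pq.
by rewrite -ry; apply: homotopic_sym.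
Qed.

(** A loop that is not null is refined and its points are joined by geodesics. *)
Lemma essential_curve : chained E -> essential E ->
  exists c, closed_curve c /\ ~ null_curve E c.
Proof.
move=> chE [x [p [lp np]]]; have e20 : 0 < eps / 2 by rewrite divr_gt0.
have e2 : eps / 2 < eps by lra.
have [q [xq pq]] := chained_refine chE e20 e2 lp.1.
have [c [[cc c0] c1 _ [r [sr qr]]]] := polygonal_curve geodesicX epsE Esym (ltW e20) e2 xq.
exists c; split; first by split=> //; rewrite c0 c1 -(homotopic_last pq) lp.2.
move=> [r' [sr' [_ r'0]]]; apply: np; split=> //.
apply: (homotopic_trans pq); apply: (homotopic_trans qr).
rewrite -c0; apply: homotopic_trans r'0; exact: subdivision_homotopic.
Qed.

End FreeClass.

(** A null curve has only constant shortest curves even if [E] is essential. Clause (1) therefore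
    takes two forms: for the given [c], with the condition that [c] is not null, and for [E] alone,
    by quantifying over closed curves. *)
Theorem proposition10 (R : realType) (X : metricType R) (E : set (X * X))
    (c : R -> X)
    (compactX : compact [set: X]) (geodesicX : geodesic_space X)
    (chainedE : chained E) (closed_c : closed_curve c) :
  (exists cb : R -> X,
     shortest_in_free_class E c cb /\ proportional_to_arclength cb) /\
  (forall cb : R -> X, shortest_in_free_class E c cb ->
     (nonconstant cb <-> essential E /\ ~ null_curve E c) /\
     (nonconstant cb ->
      forall eps : R, 0 < eps -> metric_entourage eps `<=` E ->
        closed_geodesic (3 * eps / 2) cb)) /\
  (essential E <->
     exists c' : R -> X, closed_curve c' /\
       forall cb' : R -> X, shortest_in_free_class E c' cb' -> nonconstant cb').
Proof.
have [[Esym [eps eps0 epsE]] _ _] := chainedE.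
have e20 : 0 < eps / 2 by rewrite divr_gt0.
have e2 : eps / 2 < eps by lra.
have sub (c' : R -> X) : curve c' -> exists p, subdivision E c' p.
  move=> cc'; have [p [sp _ _]] := fine_subdivision epsE cc' e20 e2.
  by exists p.
have [p0 sp0] := sub c closed_c.1.
split; first exact: (exists_shortest eps0 epsE Esym geodesicX closed_c sp0 compactX).
split=> [cb scb|].
  split; first exact: (nonconstant_shortest eps0 epsE Esym geodesicX closed_c sp0 scb).
  move=> _ e e0 eE; exact: (shortest_closed_geodesic e0 eE Esym geodesicX closed_c sp0 scb).
split=> [essE|[c' [clc' nc]]].
  have [c' [clc' nn]] := essential_curve eps0 epsE Esym geodesicX chainedE essE.
  exists c'; split=> // cb' scb'; have [p' sp'] := sub c' clc'.1.
  by apply/(nonconstant_shortest eps0 epsE Esym geodesicX clc' sp' scb').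
have [p' sp'] := sub c' clc'.1.
have [cb' [scb' _]] := exists_shortest eps0 epsE Esym geodesicX clc' sp' compactX.
by have /(nonconstant_shortest eps0 epsE Esym geodesicX clc' sp' scb')[] := nc cb' scb'.
Qed.
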